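(* There is a function $\alpha(j)=\tilde{O}(\log j)$ (with absolute implied constants) such that the following holds. Let $G=(V,E,w)$ be a connected undirected graph with nonnegative edge weights, let $0<\rho<1$, and let $v_1,v_2,\dots,v_n$ be any priority ranking of $V$. Then there exists a spanner $H$ of $G$ with lightness at most $1+\rho$ and prioritized distortion $\alpha(j)/\rho$ with respect to this ranking, i.e., for all $1\le j<i\le n$, $d_H(v_j,v_i)\le \frac{\alpha(j)}{\rho}\, d_G(v_j,v_i)$.
   Context: Edge weights are assumed distinct (ties broken consistently), so the minimum spanning tree (MST) $T$ of $G$ is unique. $d_G$ denotes the shortest-path metric of $G$. A spanner of $G$ is a subgraph $H=(V,E')$, $E'\subseteq E$, with the induced weights. The lightness of $H$ is $w(H)/w(T)$, where $w(\cdot)$ is the total edge weight. A pair $u,v$ has distortion at most $t$ in $H$ if $d_H(u,v)\le t\, d_G(u,v)$. $\tilde{O}(f(x))$ means $O(f(x)\cdot \mathrm{polylog}(f(x)))$. *)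

(* Defs.v *)
From HB Require Import structures.
From mathcomp Require Import all_boot all_order all_algebra.
From mathcomp Require Import all_classical all_reals all_analysis.

Set Implicit Arguments.
Unset Strict Implicit.
Unset Printing Implicit Defensive.

Import Order.TTheory GRing.Theory Num.Theory.
Import numFieldNormedType.Exports.

Local Open Scope classical_set_scope.
Local Open Scope ring_scope.

(* Finite simple undirected graphs on the vertex type V: an edge is a
   two-element set of vertices. The values of weight outside of edges are
   never used. *)
Record wgraph (R : realType) (V : finType) := WGraph {
  edges : {set {set V}};
  weight : {set V} -> R;
  card_edge : forall e, e \in edges -> #|e| = 2%N;
  weight_ge0 : forall e, e \in edges -> 0 <= weight e
}.

(* A subgraph with vertex set V and the induced weights is given by its edge
   set D, so the notions below take an edge set as argument, the graph itself
   being the case D = edges G. *)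

Definition adj (V : finType) (D : {set {set V}}) : rel V :=
  [rel x y | [set x; y]%SET \in D].

Definition connected_edges (V : finType) (D : {set {set V}}) : Prop :=
  forall x y : V, connect (adj D) x y.

Definition acyclic_edges (V : finType) (D : {set {set V}}) : Prop :=
  forall c : seq V, uniq c -> (2 < size c)%N -> ~~ cycle (adj D) c.

Definition total_weight (R : realType) (V : finType) (G : wgraph R V)
    (D : {set {set V}}) : R :=
  \sum_(e in D) weight G e.

Definition spanning_tree (R : realType) (V : finType) (G : wgraph R V)
    (T : {set {set V}}) : Prop :=
  [/\ T \subset edges G, connected_edges T & acyclic_edges T].

Definition minimum_spanning_tree (R : realType) (V : finType) (G : wgraph R V)
    (T : {set {set V}}) : Prop :=
  spanning_tree G T /\
  forall T' : {set {set V}},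
    spanning_tree G T' -> total_weight G T <= total_weight G T'.

(* The quotient is taken in \bar R, where 0 / 0 = 0 and x / 0 = +oo for x > 0:
   when w(T) = 0, a finite lightness forces w(H) = 0. *)
Definition lightness (R : realType) (V : finType) (G : wgraph R V)
    (T H : {set {set V}}) : \bar R :=
  ((total_weight G H)%:E / (total_weight G T)%:E)%E.

(* The weight of the walk u :: p. *)
Definition walk_weight (R : realType) (V : finType) (G : wgraph R V)
    (u : V) (p : seq V) : R :=
  \sum_(xy <- zip (u :: p) p) weight G [set xy.1; xy.2]%SET.

(* +oo when u and v are not connected in D. *)
Definition dist (R : realType) (V : finType) (G : wgraph R V)
    (D : {set {set V}}) (u v : V) : \bar R :=
  ereal_inf [set (walk_weight G u p)%:E |
             p in [set p : seq V | path (adj D) u p /\ last u p = v]].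

(* g = O(f polylog f) as the argument tends to infinity; the values of g at
   finitely many arguments are not constrained. *)
Definition soft_O (R : realType) (g f : nat -> R) : Prop :=
  exists k : nat, g =O_\oo (fun j => f j * ln (f j) ^+ k).

(* Main.v *)
Require Import Defs.
From HB Require Import structures.
From mathcomp Require Import all_boot all_order all_algebra.
From mathcomp Require Import all_classical all_reals all_analysis.
From mathcomp Require Import zify ring lra.

Set Implicit Arguments.
Unset Strict Implicit.
Unset Printing Implicit Defensive.

Import Order.TTheory GRing.Theory Num.Theory.
Import numFieldNormedType.Exports.

Local Open Scope classical_set_scope.
Local Open Scope ring_scope.

(* Adding to a tree [T] the pairs of terminals that a greedy algorithm of
   stretch [t] selects gives a graph without short weighted cycles. Let [nu]
   be the vertex measure in which every edge of [T] gives its weight to both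
   endpoints, so that balls of radius [a] have measure at least [a]. At each
   scale [a], a Moore bound on the graph of clusters of radius [r * a] shows
   that [m] selected pairs of length about [a] force the measure of balls to
   grow: [t * a * m] is at most a constant times the integral of
   [ln (nu (B (x, 2 ^ s * a)) / nu (B (x, a)))]. Summed over all scales this
   telescopes to [s * nu(V)] times the logarithm of the aspect ratio, so for
   [k] terminals a stretch [t = O(log k * log log k)] suffices for the selected
   pairs to weigh [O(w(T))].
   Shortest paths from a [T]-packing of vertices to the terminals connect all
   other vertices at cost [O(w(T))]. Applying this to the first [2 ^ 2 ^ p]
   vertices of the ranking for every [p], after multiplying the weights outside
   of [T] by [O(p ^ 2 / rho)], and taking the union gives the theorem. *)

(** * Walks of bounded cost *)

Section Linked.
Variables (R : realType) (V : Type).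
Implicit Types (C : V -> V -> R -> Prop) (x y z : V) (a b c l : R).

(* [C x y c] says that one may step from [x] to [y] at cost [c]; the upper
   bound [b] on the cost of a walk replaces infima over walks. *)
Inductive linked C : V -> V -> R -> Prop :=
| linked_refl x b : 0 <= b -> linked C x x b
| linked_step x y z c b : C x y c -> linked C y z (b - c) -> linked C x z b.

Definition cost_ge0 C := forall x y c, C x y c -> 0 <= c.
Definition cost_sym C := forall x y c, C x y c -> C y x c.

Lemma linked_ge0 C x y b : cost_ge0 C -> linked C x y b -> 0 <= b.
Proof.
move=> C0; elim=> // {}x {}y z c {}b /C0 c0 _ IH.
by rewrite -(subrK c b) addr_ge0.
Qed.

Lemma linkedW C x y b b' : b <= b' -> linked C x y b -> linked C x y b'.
Proof.
move=> le_b lk; elim: lk b' le_b => [{}x {}b b0 b' le_b|{}x {}y z c {}b s _ IH b' le_b].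
  by apply: linked_refl; apply: le_trans le_b.
by apply: linked_step s _; apply: IH; rewrite lerB.
Qed.

Lemma linked1 C x y c : C x y c -> linked C x y c.
Proof. by move=> s; apply: (linked_step s); apply: linked_refl; rewrite subrr. Qed.

Lemma linked_trans C x y z a b :
  linked C x y a -> linked C y z b -> linked C x z (a + b).
Proof.
move=> lk; elim: lk z b => [{}x {}a a0 z b|{}x {}y u c {}a s _ IH z b] lk'.
  by apply: linkedW lk'; rewrite lerDr.
by apply: (linked_step s); rewrite addrAC; apply: IH.
Qed.

Lemma linked_transW C x y z a b c :
  linked C x y a -> linked C y z b -> a + b <= c -> linked C x z c.
Proof. by move=> h1 h2 le_c; apply: linkedW le_c (linked_trans h1 h2). Qed.

Lemma linked_sym C x y b : cost_sym C -> linked C x y b -> linked C y x b.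
Proof.
move=> Cs; elim=> [{}x {}b b0|{}x {}y z c {}b s _ IH]; first exact: linked_refl.
by rewrite -(subrK c b); apply: linked_trans IH (linked1 (Cs _ _ _ s)).
Qed.

Lemma linked_lift C C' l x y b : 0 <= l ->
  (forall x y c, C x y c -> linked C' x y (l * c)) ->
  linked C x y b -> linked C' x y (l * b).
Proof.
move=> l0 h; elim=> [{}x {}b b0|{}x {}y z c {}b s _ IH].
  by apply: linked_refl; rewrite mulr_ge0.
by rewrite -(subrKC c b) mulrDr; apply: linked_trans (h _ _ _ s) IH.
Qed.

Lemma linked_mono C C' x y b :
  (forall x y c, C x y c -> C' x y c) -> linked C x y b -> linked C' x y b.
Proof.
move=> h; have := @linked_lift C C' 1 x y b ler01; rewrite mul1r; apply.
by move=> u v c /h /linked1; rewrite mul1r.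
Qed.

(* A walk either avoids the additional edge [pq] or can be shortened so as to
   use it exactly once. *)
Lemma linked_add_edge C C' p q w x y b : 0 <= w -> cost_ge0 C ->
  (forall x y c, C' x y c ->
     C x y c \/ c = w /\ ((x = p /\ y = q) \/ (x = q /\ y = p))) ->
  linked C' x y b ->
  linked C x y b \/
  exists b1 b2, b1 + w + b2 <= b /\
    ((linked C x p b1 /\ linked C q y b2) \/
     (linked C x q b1 /\ linked C p y b2)).
Proof.
move=> w0 C0 h; elim=> [{}x {}b b0|{}x {}y z c {}b /h s _ IH].
  by left; apply: linked_refl.
case: s IH => [s|[-> [[-> ->]|[-> ->]]]] [lk|[b1 [b2 [le_b H]]]].
- by left; apply: linked_step s lk.
- right; exists (c + b1), b2; split; first by rewrite -!addrA -lerBrDl addrA.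
  case: H => -[k1 k2]; [left|right]; split=> //;
    exact: linked_trans (linked1 s) k1.
- right; exists 0, (b - w); split; first by rewrite add0r subrKC.
  by left; split=> //; apply: linked_refl.
- case: H => -[k1 k2]; last first.
    left; apply: linkedW k2; have := linked_ge0 C0 k1; lra.
  right; exists 0, b2; split; first by have := linked_ge0 C0 k1; lra.
  by left; split=> //; apply: linked_refl.
- right; exists 0, (b - w); split; first by rewrite add0r subrKC.
  by right; split=> //; apply: linked_refl.
- case: H => -[k1 k2].
    left; apply: linkedW k2; have := linked_ge0 C0 k1; lra.
  right; exists 0, b2; split; first by have := linked_ge0 C0 k1; lra.
  by right; split=> //; apply: linked_refl.
Qed.

End Linked.

(** Otherwise [f] would more than double [Q + 1] times and exceed its bound. Both ball carvings
    below stop at such a [j]. *)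
Lemma exists_non_doubling (f : nat -> nat) (Q : nat) :
  (0 < f 0%N)%N -> (forall j, (f j <= 2 ^ Q)%N) ->
  exists2 j, (j <= Q)%N & (f j.+1 <= 2 * f j)%N.
Proof.
move=> f0 fQ; apply: contrapT => no.
have gt j : (j <= Q.+1)%N -> (2 ^ j <= f j)%N.
  elim: j => [_|j IH lej]; first by rewrite expn0.
  have := IH (ltnW lej); rewrite expnS => h.
  have [le|lt] := leqP (f j.+1) (2 * f j); first by case: no; exists j.
  by apply: leq_trans (ltnW lt); rewrite leq_mul2l.
by have := leq_trans (gt _ (leqnn _)) (fQ Q.+1); rewrite leq_exp2l // ltnn.
Qed.

(** * Moore bound *)

Section Moore.
Variables (I J : finType) (s t : J -> I).
Implicit Types (F : {set J}) (X : {set I}) (x y : I).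

(** Edges are indices with endpoint maps, because moving the ends of pairs to net points may a
    priori create loops and parallel edges. *)
Definition incident F x y :=
  [exists e in F, (s e == x) && (t e == y) || (t e == x) && (s e == y)].

Fixpoint reach F x k : {set I} :=
  if k is k'.+1 then
    (reach F x k' :|: [set y | [exists z in reach F x k', incident F z y]])%SET
  else [set x]%SET.

Lemma incidentS F F' x y : F \subset F' -> incident F x y -> incident F' x y.
Proof.
move=> /fintype.subsetP sF /existsP[e /andP[/sF eF h]]; apply/existsP; exists e.
by rewrite eF.
Qed.

Lemma reachS F F' x k : F \subset F' -> reach F x k \subset reach F' x k.
Proof.
move=> sF; elim: k => //= k IH; apply: finset.setUSS => //.
apply/fintype.subsetP => y; rewrite !inE => /existsP[z /andP[zr h]].
by apply/existsP; exists z; rewrite (fintype.subsetP IH) //= (incidentS sF).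
Qed.

Lemma mem_reach F x k : x \in reach F x k.
Proof. by elim: k => /= [|k IH]; rewrite !inE ?IH. Qed.

Lemma reach_endpoints F x k e : e \in F ->
  (s e \in reach F x k) || (t e \in reach F x k) ->
  (s e \in reach F x k.+1) && (t e \in reach F x k.+1).
Proof.
move=> eF /= h; rewrite !inE; case/orP: h => h; rewrite h /=.
  apply/orP; right; apply/existsP; exists (s e); rewrite h /=.
  by apply/existsP; exists e; rewrite eF !eqxx.
rewrite andbT; apply/orP; right; apply/existsP; exists (t e); rewrite h /=.
by apply/existsP; exists e; rewrite eF !eqxx orbT.
Qed.

Lemma reach_sub F X x k : x \in X ->
  (forall e, e \in F -> (s e \in X) && (t e \in X)) -> reach F x k \subset X.
Proof.
move=> xX FX; elim: k => /= [|k IH]; first by rewrite finset.sub1set.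
rewrite finset.subUset IH /=; apply/fintype.subsetP => y; rewrite inE => /existsP[z].
case/andP=> _ /existsP[e /andP[/FX/andP[sX tX]]].
by case/orP => /andP[_ /eqP<-].
Qed.

(* A breadth-first search tree. *)
Lemma reach_tree F x k : exists2 D : {set J}, D \subset F &
  (#|D| <= #|reach F x k|)%N /\ reach F x k \subset reach D x k.
Proof.
elim: k => [|k [D DF [cD rD]]].
  exists finset.set0; first exact: finset.sub0set.
  by rewrite cards0 /= subxx; split.
pose new := (reach F x k.+1 :\: reach F x k)%SET.
have parent y : y \in new ->
    exists2 e, e \in F & exists2 z, z \in reach F x k &
      incident [set e]%SET z y.
  rewrite !inE => /andP[/negbTE-> /= /existsP[z /andP[zr]]].
  case/existsP=> e /andP[eF h]; exists e => //; exists z => //.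
  by apply/existsP; exists e; rewrite finset.set11.
(* A parent edge for each new vertex; the values are options because [J] may be empty. *)
have [par parP] : exists par : I -> option J, forall y, y \in new ->
    exists2 e, par y = Some e & e \in F /\
      exists2 z, z \in reach F x k & incident [set e]%SET z y.
  exists (fun y => [pick e in F | [exists z in reach F x k,
      incident [set e]%SET z y]]) => y /parent[e0 e0F [z0 z0r h0]].
  case: pickP => [e /andP[eF /existsP[z /andP[zr h]]]|/(_ e0)].
    by exists e => //; split=> //; exists z.
  rewrite e0F /= => /negbT/existsP[]; by exists z0; rewrite z0r.
pose P := [set e | Some e \in par @: new]%SET.
exists (D :|: (P :&: F))%SET.
  by rewrite finset.subUset DF finset.subsetIr.
split.
  have -> : reach F x k.+1 = (reach F x k :|: new)%SET.
    by apply/setP => y; rewrite /= !inE; case: (y \in reach F x k).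
  have cU : #|(reach F x k :|: new)%SET| = (#|reach F x k| + #|new|)%N.
    rewrite cardsU; have -> : (reach F x k :&: new = finset.set0)%SET.
      by apply/setP => y; rewrite !inE; case: (y \in reach F x k).
    by rewrite cards0 subn0.
  rewrite cU (leq_trans (leq_card_setU _ _)) // leq_add //.
  apply: leq_trans (subset_leq_card (finset.subsetIl _ _)) _.
  apply: leq_trans (leq_imset_card par new).
  rewrite -(card_imset P Some_inj); apply: subset_leq_card.
  by apply/fintype.subsetP => o /imsetP[e]; rewrite inE => h ->.
apply/fintype.subsetP => y yr; case: (boolP (y \in reach F x k)) => [yk|yk].
  rewrite /= inE; apply/orP; left.
  apply: (fintype.subsetP (reachS x k (finset.subsetUl D _))).
  by apply: (fintype.subsetP rD).
have yn : y \in new by rewrite finset.in_setD yk yr.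
case: (parP _ yn) => e pe [eF [z zr h]] /=; rewrite !inE; apply/orP; right.
apply/existsP; exists z; apply/andP; split.
  apply: (fintype.subsetP (reachS x k (finset.subsetUl D _))).
  by apply: (fintype.subsetP rD).
apply: incidentS h; rewrite finset.sub1set !inE eF andbT; apply/orP; right.
by apply/imsetP; exists y.
Qed.

(* Moore bound, by ball carving: a ball [B] that at most doubles in the next
   step only meets edges of its search tree, hence at most [2 * #|B|] edges. *)
Lemma moore_bound (b : nat) F X :
  (forall e, e \in F -> (s e \in X) && (t e \in X)) ->
  (#|X| <= 2 ^ b)%N ->
  (forall e x, e \in F ->
     ~~ ((s e \in reach (F :\ e)%SET x b.+1) &&
         (t e \in reach (F :\ e)%SET x b.+1))) ->
  (#|F| <= 2 * #|X|)%N.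
Proof.
move: {2}#|X| (leqnn #|X|) => n; elim: n F X => [|n IH] F X leX FX Xb Fb.
  have [->|[e eF]] := set_0Vmem F; first by rewrite cards0.
  have /andP[sX _] := FX _ eF.
  by move: leX; rewrite leqn0 cards_eq0 => /eqP X0; rewrite X0 inE in sX.
have [->|[e0 e0F]] := set_0Vmem F; first by rewrite cards0.
have /andP[x0X _] := FX _ e0F; set x0 := s e0 in x0X.
have [|j|j lej dbl] := @exists_non_doubling (fun j => #|reach F x0 j|) b.
- by rewrite /= cards1.
- exact: leq_trans (subset_leq_card (reach_sub _ x0X FX)) Xb.
set B := reach F x0 j in dbl; set B' := reach F x0 j.+1 in dbl.
pose FB := [set e in F | (s e \in B) || (t e \in B)]%SET.
have [D DF [cD rD]] := reach_tree F x0 j.+1.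
(* The tree reaches both endpoints of any edge that meets [B]; an edge outside of the tree would
   thus close a forbidden short cycle. *)
have FBD : FB \subset D.
  apply/fintype.subsetP => e; rewrite inE => /andP[eF eB]; apply: contraT => eD.
  have /andP[sB tB] := reach_endpoints eF eB.
  have sub : reach D x0 j.+1 \subset reach (F :\ e)%SET x0 b.+1.
    apply: (@fintype.subset_trans _ _ (mem (reach D x0 b.+1))).
      rewrite -(subnKC (lej : (j.+1 <= b.+1)%N)).
      elim: (b.+1 - j.+1)%N => [|k IHk]; first by rewrite addn0.
      by rewrite addnS /=; apply: fintype.subset_trans IHk (finset.subsetUl _ _).
    apply: reachS; apply/fintype.subsetP => f fD.
    by rewrite !inE (fintype.subsetP DF _ fD) andbT; apply: contraNneq eD => <-.
  have := Fb e x0 eF; rewrite (fintype.subsetP sub) ?(fintype.subsetP rD) //=.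
  by rewrite (fintype.subsetP sub) ?(fintype.subsetP rD).
have leFB : (#|FB| <= 2 * #|B|)%N.
  exact: leq_trans (subset_leq_card FBD) (leq_trans cD dbl).
have BX : B \subset X := reach_sub _ x0X FX.
have B0 : (0 < #|B|)%N by apply/card_gt0P; exists x0; apply: mem_reach.
have cX : #|X| = (#|B| + #|X :\: B|)%N.
  by rewrite -(cardsID B X) (finset.setIidPr BX).
(* The edges outside of [FB] avoid [B], so the induction continues on [X :\: B]. *)
have le2 : (#|F :\: FB| <= 2 * #|X :\: B|)%N.
  apply: IH; first by move: leX; rewrite cX; lia.
  - move=> e; rewrite !inE => /andP[eFB eF]; have /andP[-> ->] := FX _ eF.
    by move: eFB; rewrite eF /= negb_or => /andP[-> ->].
  - by apply: leq_trans Xb; apply/subset_leq_card/finset.subsetDl.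
  - move=> e x /finset.setDP[eF _]; apply: contra (Fb e x eF).
    have /fintype.subsetP sub := reachS x b.+1
      (finset.setSD [set e]%SET (finset.subsetDl F FB)).
    by move=> /andP[h1 h2]; rewrite (sub _ h1) (sub _ h2).
have cF : #|F| = (#|FB| + #|F :\: FB|)%N.
  rewrite -(cardsID FB F); congr addn; rewrite (finset.setIidPr _) //.
  by apply/fintype.subsetP => e; rewrite inE => /andP[].
by rewrite cF cX mulnDr leq_add.
Qed.

End Moore.

(** * Entropy and nets *)

Lemma ln2_ge_half (R : realType) : 1 / 2 <= ln 2 :> R.
Proof.
have := @le_ln1Dx R (- (1 / 2)).
have -> : 1 + - (1 / 2) = 2^-1 :> R by lra.
rewrite lnV ?posrE // => h.
have /h : -1 < - (1 / 2) :> R by lra.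
lra.
Qed.

Lemma sum_bigcup_disjoint (R : realType) (I T : finType) (N : {set I})
    (A : I -> {set T}) (g : T -> R) :
  (forall i j x, i \in N -> j \in N -> x \in A i -> x \in A j -> i = j) ->
  \sum_(x in (\bigcup_(i in N) A i)%SET) g x = \sum_(i in N) \sum_(x in A i) g x.
Proof.
move=> dis; pose A' i := if i \in N then A i else finset.set0.
have -> : (\bigcup_(i in N) A i = \bigcup_i A' i)%SET.
  by rewrite big_mkcond.
rewrite partition_disjoint_bigcup => [|i j neq].
  rewrite [RHS]big_mkcond /=; apply: eq_bigr => i _; rewrite /A'.
  by case: ifP => // _; rewrite big_set0.
rewrite /A'; case: ifP => iN; case: ifP => jN;
  rewrite -finset.setI_eq0 ?finset.set0I ?finset.setI0 //.
apply/eqP/setP => x; rewrite !inE; apply/negP => /andP[xi xj].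
by move: neq; rewrite (dis i j x) ?eqxx.
Qed.

(* The Kullback-Leibler divergence from the uniform distribution is
   nonnegative. *)
Lemma le_sum_ln_ratio (R : realType) (I : finType) (N : {set I}) (f : I -> R)
    (M := \sum_(i in N) f i) :
  (forall i, i \in N -> 0 < f i) ->
  #|N|%:R * ln (#|N|%:R : R) <= \sum_(i in N) (ln M - ln (f i)).
Proof.
move=> f0; have [->|[i0 i0N]] := set_0Vmem N.
  by rewrite cards0 mul0r big_set0.
have K0 : 0 < #|N|%:R :> R by rewrite ltr0n; apply/card_gt0P; exists i0.
have M0 : 0 < M.
  rewrite /M (bigD1 i0) //= ltr_pwDl ?f0 // sumr_ge0 // => i /andP[/f0/ltW //].
(* This is [ln q <= q - 1] for [q = f i * #|N| / M]; the right-hand sides sum to zero. *)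
have le i : i \in N ->
    ln (#|N|%:R : R) - (ln M - ln (f i)) <= f i * (#|N|%:R / M) - 1.
  move=> /f0 fi; set q := f i * _.
  have q0 : 0 < q by rewrite mulr_gt0 ?divr_gt0.
  have -> : ln (#|N|%:R : R) - (ln M - ln (f i)) = ln q.
    rewrite /q lnM ?posrE ?divr_gt0 // ln_div ?posrE //; lra.
  by have := @le_ln1Dx R (q - 1); rewrite subrKC; apply; lra.
have := @ler_sum R I (index_enum I) (mem N) _ _ le.
rewrite !sumrB !sumr_const -mulr_suml -/M mulrCA divff ?gt_eqF // mulr1.
rewrite -[X in X - _]mulr_natl; lra.
Qed.

Section Net.
Variables (R : realType) (V : finType) (C : V -> V -> R -> Prop).

Definition ball_set x (a : R) : {set V} := [set y | `[< linked C x y a >]]%SET.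

Lemma ball_setP x a y : reflect (linked C x y a) (y \in ball_set x a).
Proof. by rewrite inE; apply: asboolP. Qed.

(** Greedy choice: a point joins the net unless the net already covers it. *)
Lemma separated_net (P : {set V}) (a : R) : 0 <= a -> cost_sym C ->
  exists N : {set V}, [/\ N \subset P,
    forall y z, y \in N -> z \in N -> y != z -> ~ linked C y z a &
    forall x, x \in P -> exists2 y, y \in N & linked C x y a].
Proof.
move=> a0 Cs; move: {2}#|P| (leqnn #|P|) => n; elim: n P => [|n IH] P cP.
  exists finset.set0; split=> [|y z|x xP]; rewrite ?finset.sub0set ?inE //.
  by move: cP; rewrite leqn0 cards_eq0 => /eqP P0; rewrite P0 inE in xP.
have [->|[p pP]] := set_0Vmem P.
  by exists finset.set0; split=> [|y z|x]; rewrite ?finset.sub0set ?inE.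
have [|N [NP sep cov]] := IH (P :\ p)%SET.
  by move: cP; rewrite (cardsD1 p P) pP.
have [[y yN py]|far] := pselect (exists2 y, y \in N & linked C p y a).
  exists N; split=> //; first exact: fintype.subset_trans NP (finset.subsetDl _ _).
  move=> x xP; have [->|neq] := eqVneq x p; first by exists y.
  by apply: cov; rewrite !inE neq.
exists (p |: N)%SET; split.
- rewrite finset.subUset finset.sub1set pP.
  exact: fintype.subset_trans NP (finset.subsetDl _ _).
- move=> y z; rewrite !inE => /predU1P[->|yN] /predU1P[->|zN] neq lk.
  + by rewrite eqxx in neq.
  + by case: far; exists z.
  + by case: far; exists y => //; apply: linked_sym lk.
  + exact: sep lk.
- move=> x xP; have [->|neq] := eqVneq x p.
    by exists p; [rewrite !inE eqxx|apply: linked_refl].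
  have [|y yN lk] := cov x; first by rewrite !inE neq.
  by exists y; rewrite // !inE yN orbT.
Qed.

End Net.

(** * Weight of pairs of large girth *)

Section LightPairs.
Variables (R : realType) (V : finType) (C0 : V -> V -> R -> Prop).
Variables (d : V -> V -> R) (nu : V -> R) (M t : R) (Q s : nat).
Hypothesis C0_ge0 : cost_ge0 C0.
Hypothesis C0_sym : cost_sym C0.
Hypothesis d_ge0 : forall x y, 0 <= d x y.
Hypothesis d_sym : forall x y, d x y = d y x.
Hypothesis nu_ge0 : forall x, 0 <= nu x.
Hypothesis M_def : M = \sum_x nu x.

Definition vol (S : {set V}) : R := \sum_(x in S) nu x.

(** For the endpoint measure of a tree this is [incident_ball_lower]. *)
Hypothesis ball_lower : forall x y (a : R), 0 <= a -> ~ linked C0 x y a ->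
  a < vol (ball_set C0 x a).

Definition pairs_cost (F : {set V * V}) (x y : V) (c : R) : Prop :=
  C0 x y c \/ ((x, y) \in F \/ (y, x) \in F) /\ c = d x y.

Definition pairs_below (E : {set V * V}) (a : R) : {set V * V} :=
  [set e in E | d e.1 e.2 < a]%SET.

Lemma pairs_cost_ge0 F : cost_ge0 (pairs_cost F).
Proof. by move=> x y c [/C0_ge0//|[_ ->]]. Qed.

Lemma pairs_cost_sym F : cost_sym (pairs_cost F).
Proof.
move=> x y c [/C0_sym h|[h ->]]; first by left.
by right; rewrite d_sym; split=> //; case: h; [right|left].
Qed.

Lemma linked_pairs_mono (F F' : {set V * V}) x y a : F \subset F' ->
  linked (pairs_cost F) x y a -> linked (pairs_cost F') x y a.
Proof.
move=> /fintype.subsetP sF; apply: linked_mono => u v c [h|[h ->]].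
  by left.
by right; split=> //; case: h => /sF; [left|right].
Qed.

Lemma linked_pairs_base F x y a : linked C0 x y a -> linked (pairs_cost F) x y a.
Proof. by apply: linked_mono => u v c h; left. Qed.

Lemma linked_pair (F : {set V * V}) e :
  e \in F -> linked (pairs_cost F) e.1 e.2 (d e.1 e.2).
Proof.
by move=> eF; apply: linked1; right; rewrite -surjective_pairing; split=> //; left.
Qed.

Lemma pairs_belowS E a b : a <= b -> pairs_below E a \subset pairs_below E b.
Proof.
move=> ab; apply/fintype.subsetP => e; rewrite !inE => /andP[-> h] /=.
exact: lt_le_trans ab.
Qed.

Lemma volS (S S' : {set V}) : S \subset S' -> vol S <= vol S'.
Proof.
move=> sS; rewrite /vol [leRHS](big_setID S) /= (finset.setIidPr sS) lerDl.
by apply: sumr_ge0.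
Qed.

Lemma vol_le (S : {set V}) : vol S <= M.
Proof.
rewrite M_def [leRHS](_ : _ = vol [set: V]%SET); last first.
  by apply: eq_bigl => x; rewrite inE.
exact/volS/finset.subsetT.
Qed.

Lemma base_linked_total x y a : 0 <= a -> M <= a -> linked C0 x y a.
Proof.
move=> a0 Ma; apply: contrapT => /(ball_lower a0).
by rewrite ltNge (le_trans (vol_le _) Ma).
Qed.

(** A ball that misses a vertex falls under [ball_lower]; a ball that misses none has measure [M],
    whence the bound on [a]. *)
Lemma vol_ball_ge F x a : 0 <= a -> a <= M ->
  a <= vol (ball_set (pairs_cost F) x a).
Proof.
move=> a0 aM.
have sub : ball_set C0 x a \subset ball_set (pairs_cost F) x a.
  by apply/fintype.subsetP => y /ball_setP/(linked_pairs_base F)/ball_setP.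
apply: le_trans (volS sub).
have [[y /(ball_lower a0)/ltW//]|all] := pselect (exists y, ~ linked C0 x y a).
rewrite (_ : ball_set C0 x a = [set: V]%SET); last first.
  apply/setP => y; rewrite [RHS]inE; apply/ball_setP; apply: contrapT => h.
  by apply: all; exists y.
by rewrite /vol (eq_bigl predT) -?M_def // => y; rewrite inE.
Qed.

Variable E : {set V * V}.

(** A weighted girth condition: a cycle through [e] is longer than [t + 1] times [e]. *)
Definition girth_gt := forall e, e \in E ->
  ~ linked (pairs_cost (E :\ e)) e.1 e.2 (t * d e.1 e.2).

Hypothesis girthE : girth_gt.
(** [t_ge] ensures that the cluster radius [r * a] is at least [4 * a]; [s_ge] makes a ball of
    radius [2 ^+ s * a] contain a whole carved piece, as used in [gain_ge]. *)
Hypothesis t_ge : 128 * (Q.+1)%:R <= t.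
Hypothesis s_ge : 3 * Q%:R * t <= 2 ^+ s.
Hypothesis Q_gt0 : (0 < Q)%N.

Lemma t_ge256 : 256 <= t.
Proof.
have : (2%:R : R) <= (Q.+1)%:R by rewrite ler_nat.
by move: t_ge; lra.
Qed.

Lemma t_gt0 : 0 < t. Proof. by have := t_ge256; lra. Qed.

(** From radius [M] on, [C0] alone links all vertices, against the girth condition. *)
Lemma pair_lt_M e : e \in E -> t * d e.1 e.2 < M.
Proof.
move=> eE; have td : 0 <= t * d e.1 e.2 by rewrite mulr_ge0 ?d_ge0 // ltW // t_gt0.
rewrite ltNge; apply/negP => /(base_linked_total e.1 e.2 td).
by move/(linked_pairs_base (E :\ e)%SET); apply: girthE.
Qed.

(* Over dyadic scales [a] the gains telescope, with [s]-fold overlap. *)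
Definition ln_vol (a : R) (x : V) : R :=
  ln (vol (ball_set (pairs_cost (pairs_below E a)) x a)).
Definition gain (a : R) (x : V) : R := ln_vol (2 ^+ s * a) x - ln_vol a x.

(** * Volume growth at a single scale *)

Section Scale.
Variable a : R.
Hypothesis a_gt0 : 0 < a.
Notation N0 := (pairs_cost (pairs_below E a)).
Notation N1 := (pairs_cost (pairs_below E (2 * a))).

Lemma linked_N01 x y b : linked N0 x y b -> linked N1 x y b.
Proof. by apply/linked_pairs_mono/pairs_belowS; move: a_gt0; lra. Qed.

Section Core.
(** One piece of the carving performed in [scale_region], with centre [x0]. *)
Variables (F : {set V * V}) (x0 : V).
Hypothesis FE : F \subset E.
Hypothesis F_scale : forall e, e \in F -> a <= d e.1 e.2 < 2 * a.
Hypothesis F_gt0 : (0 < #|F|)%N.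
Hypothesis F_le : (#|F| <= 2 ^ Q)%N.
Hypothesis F_near : forall e, e \in F -> linked N1 x0 e.1 (Q%:R * t * a).

(* [r * a] is the coarsest resolution at which a cycle of [O(b)] clusters and
   pairs still violates the girth condition. *)
Let b := (trunc_log 2 #|F|).+1.
Let r := t / (32 * b%:R).
Let P := ([set e.1 | e in F] :|: [set e.2 | e in F])%SET.

Let FEb e : e \in F -> e \in E. Proof. exact: fintype.subsetP. Qed.

Let b_bounds : (2 ^ b.-1 <= #|F| < 2 ^ b)%N.
Proof. exact: trunc_log_bounds. Qed.

Let b_le : (b <= Q.+1)%N.
Proof.
have /andP[h _] := b_bounds; have := leq_trans h F_le.
by rewrite leq_exp2l.
Qed.

Let b_ge1 : 1 <= b%:R :> R. Proof. by rewrite ler1n. Qed.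

Let b_gt0 : 0 < b%:R :> R. Proof. by rewrite ltr0n. Qed.

Let br : 32 * b%:R * r = t.
Proof. by rewrite /r mulrC divfK // gt_eqF // mulr_gt0. Qed.

Let r_ge4 : 4 <= r.
Proof.
rewrite /r ler_pdivlMr; last by rewrite mulr_gt0.
apply: le_trans t_ge; rewrite mulrA; have -> : (4 * 32 = 128 :> R) by lra.
by rewrite ler_pM2l // ler_nat.
Qed.

Let r_le : 32 * r <= t.
Proof. rewrite -br; have := r_ge4; have := b_ge1; nra. Qed.

(** The pairs that define [N0] survive the removal of [e], so walks inside clusters may be used to
    close a cycle through [e]. *)
Let below_sub e : e \in F -> pairs_below E a \subset (E :\ e)%SET.
Proof.
move=> eF; apply/fintype.subsetP => f; rewrite !inE => /andP[-> lt].
rewrite andbT; apply: contraTneq lt => ->; rewrite -leNgt.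
by case/andP: (F_scale eF).
Qed.

Let far e : e \in F -> ~ linked (pairs_cost (E :\ e)) e.1 e.2 (t * a).
Proof.
move=> eF /(@linkedW _ _ _ _ _ _ (t * d e.1 e.2)) h; apply: (girthE (FEb eF)).
by apply: h; rewrite ler_pM2l ?t_gt0 //; case/andP: (F_scale eF).
Qed.

Let pair_step e : e \in F -> linked N1 e.1 e.2 (2 * a).
Proof.
move=> eF; have /andP[_ /[dup] lt /ltW le2] := F_scale eF; apply: linkedW le2 _.
by apply: linked_pair; rewrite inE FEb.
Qed.

Let taM : t * a < M.
Proof.
have /card_gt0P[e eF] := F_gt0; apply: le_lt_trans (pair_lt_M (FEb eF)).
by rewrite ler_pM2l ?t_gt0 //; case/andP: (F_scale eF).
Qed.

Section SeparatedNet.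
Variables (N : {set V}) (c : V -> V).
Hypothesis NP : N \subset P.
Hypothesis N_sep : forall y z, y \in N -> z \in N -> y != z ->
  ~ linked N0 y z (r * a).
Hypothesis cP : forall x, x \in P -> c x \in N /\ linked N0 x (c x) (r * a).

Let P1 e : e \in F -> e.1 \in P.
Proof. by move=> eF; rewrite inE; apply/orP; left; apply/imsetP; exists e. Qed.
Let P2 e : e \in F -> e.2 \in P.
Proof. by move=> eF; rewrite inE; apply/orP; right; apply/imsetP; exists e. Qed.

(** A hop in the cluster graph goes from a net point to an end of a pair, along the pair, and on to
    a net point: [r + 2 + r] times [a]. *)
Let reach_linked e k x y : e \in F ->
  y \in reach (fun f : V * V => c f.1) (fun f => c f.2) (F :\ e)%SET x k ->
  linked (pairs_cost (E :\ e)) x y (k%:R * ((2 * r + 2) * a)).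
Proof.
move=> eF; have w0 : 0 <= (2 * r + 2) * a.
  by rewrite mulr_ge0 ?ltW //; have := r_ge4; lra.
have FeE : (F :\ e \subset E :\ e)%SET by apply: finset.setSD.
have hop f : f \in (F :\ e)%SET ->
    linked (pairs_cost (E :\ e)) (c f.1) (c f.2) ((2 * r + 2) * a).
  move=> fFe; have fF : f \in F by case/finset.setD1P: fFe.
  have [_ /(linked_pairs_mono (below_sub eF)) l1] := cP (P1 fF).
  have [_ /(linked_pairs_mono (below_sub eF)) l2] := cP (P2 fF).
  have l0 : linked (pairs_cost (E :\ e)) f.1 f.2 (2 * a).
    have /andP[_ /ltW le2] := F_scale fF; apply: linkedW le2 _.
    by apply: linked_pair; apply: (fintype.subsetP FeE).
  have l1' := linked_sym (@pairs_cost_sym _) l1.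
  by apply: linked_transW (linked_trans l1' l0) l2 _; lra.
elim: k y => [|k IH] y /=; rewrite inE.
  by move/eqP->; apply: linked_refl; rewrite mul0r.
case/orP=> [/IH|]; first by apply: linkedW; rewrite ler_wpM2r // ler_nat.
rewrite inE => /existsP[z /andP[/IH l /existsP[f /andP[fF h]]]].
apply: (linked_transW l (b := (2 * r + 2) * a)); last by rewrite -[k.+1]addn1 natrD; lra.
case/orP: h => /andP[/eqP<- /eqP<-]; first exact: hop.
exact: linked_sym (@pairs_cost_sym _) (hop _ fF).
Qed.

Let net_card : (#|F| <= 2 * #|N|)%N.
Proof.
apply: (@moore_bound _ _ (fun f : V * V => c f.1) (fun f => c f.2) b.+1).
- by move=> e eF; rewrite (cP (P1 eF)).1 (cP (P2 eF)).1.
- apply: leq_trans (subset_leq_card NP) _.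
  apply: leq_trans (leq_card_setU _ _) _.
  have /andP[_ /ltnW lt] := b_bounds; rewrite expnS mul2n -addnn.
  by rewrite leq_add // (leq_trans (leq_imset_card _ _)).
move=> e x eF; apply/negP => /andP[/(reach_linked eF) l1 /(reach_linked eF) l2].
have [_ /(linked_pairs_mono (below_sub eF)) k1] := cP (P1 eF).
have [_ /(linked_pairs_mono (below_sub eF)) k2] := cP (P2 eF).
apply: (far eF); have sy := @pairs_cost_sym (E :\ e)%SET.
apply: linked_transW (linked_trans k1 (linked_sym sy l1))
  (linked_trans l2 (linked_sym sy k2)) _.
(* Two walks of [b + 2] hops each, plus [2 * r] to attach the ends of [e], fit into
   [t = 32 * b * r], against [far]. *)
rewrite -br -[b.+2]addn2 natrD; have := a_gt0; have := r_ge4; have := b_ge1.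
set B := b%:R => B1 r4 a0.
rewrite [leLHS](_ : _ = (2 * (B + 2) * (2 * r + 2) + 2 * r) * a); last by ring.
by rewrite ler_pM2r //; nra.
Qed.

(** Two net points make [ln #|N|] at least [ln 2], which absorbs the additive constants in
    [core_region_gain]. *)
Let net_card2 : (1 < #|N|)%N.
Proof.
have /card_gt0P[e eF] := F_gt0.
have [c1 k1] := cP (P1 eF); have [c2 k2] := cP (P2 eF).
apply/card_gt1P; exists (c e.1), (c e.2); split=> //.
apply/eqP => eqc; apply: (far eF).
apply: (linked_pairs_mono (below_sub eF)); rewrite -eqc in k2.
apply: linked_transW k1 (linked_sym (@pairs_cost_sym _) k2) _.
by have := a_gt0; have := r_le; have := r_ge4; nra.
Qed.

(** Radius [r / 2] keeps the balls around net points disjoint. Radius [r / 4] leaves room for a ball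
    of radius [a] around each point of [sigma y] inside [beta y], since [r] is at least 4. *)
Let beta y := ball_set N0 y (r / 2 * a).
Let sigma y := ball_set N0 y (r / 4 * a).
Let Y := (\bigcup_(y in N) sigma y)%SET.

Let beta_disjoint y z x : y \in N -> z \in N -> x \in beta y -> x \in beta z -> y = z.
Proof.
move=> yN zN /ball_setP ly /ball_setP lz; apply/eqP; apply: contraT => neq.
case: (N_sep yN zN neq).
by apply: linked_transW ly (linked_sym (@pairs_cost_sym _) lz) _; lra.
Qed.

Let sigma_beta y : sigma y \subset beta y.
Proof.
apply/fintype.subsetP => x /ball_setP l; apply/ball_setP; apply: linkedW l.
by have := a_gt0; have := r_ge4; nra.
Qed.

Let net_endpoint y : y \in N -> exists2 e, e \in F & linked N1 e.1 y (2 * a).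
Proof.
move=> /(fintype.subsetP NP); rewrite inE => /orP[] /imsetP[e eF ->]; exists e => //.
  by apply: linked_refl; have := a_gt0; lra.
exact: pair_step.
Qed.

(** This proximity makes the regions of different pieces disjoint in [scale_region]. *)
Lemma core_region_near x : x \in Y ->
  exists2 e, e \in F & linked N1 e.1 x (t / 4 * a).
Proof.
case/finset.bigcupP => y yN /ball_setP/linked_N01 l.
have [e eF l'] := net_endpoint yN; exists e => //.
apply: linked_transW l' l _; have := a_gt0; have := r_le; have := t_ge256; nra.
Qed.

Let sigma_vol y : r / 4 * a <= vol (sigma y).
Proof.
apply: vol_ball_ge; first by have := a_gt0; have := r_ge4; nra.
by apply: le_trans (ltW taM); have := a_gt0; have := r_le; have := r_ge4; nra.
Qed.

Let beta_vol_gt0 y : 0 < vol (beta y).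
Proof.
apply: lt_le_trans (volS (sigma_beta y)); apply: lt_le_trans (sigma_vol y).
by have := a_gt0; have := r_ge4; nra.
Qed.

Let U := (\bigcup_(y in N) beta y)%SET.

Let volU : vol U = \sum_(y in N) vol (beta y).
Proof. by apply: sum_bigcup_disjoint => i j x; apply: beta_disjoint. Qed.

(** The small ball around [x] lies in [beta y], while the large one contains [U]: any two pairs of
    [F] are joined through [x0] at cost [2 * Q * t * a], and the third [Q * t * a] pays for the
    detours at both ends. *)
Let gain_ge y x : y \in N -> x \in sigma y ->
  ln (vol U) - ln (vol (beta y)) <= gain a x.
Proof.
move=> yN xs; have /ball_setP l := xs; rewrite /gain /ln_vol.
have x_small : ball_set N0 x a \subset beta y.
  apply/fintype.subsetP => z /ball_setP lz; apply/ball_setP.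
  by apply: linked_transW l lz _; have := a_gt0; have := r_ge4; nra.
have s2 : 2 * a <= 2 ^+ s * a.
  rewrite ler_pM2r //; apply: le_trans s_ge.
  have : 1 <= Q%:R :> R by rewrite ler1n.
  by have := t_ge256; nra.
have big : U \subset
    ball_set (pairs_cost (pairs_below E (2 ^+ s * a))) x (2 ^+ s * a).
  apply/fintype.subsetP => z /bigcupP[y' y'N /ball_setP/linked_N01 lz].
  apply/ball_setP; apply: (linked_pairs_mono (pairs_belowS E s2)).
  have [e eF le] := net_endpoint yN; have [e' e'F le'] := net_endpoint y'N.
  have sy := @pairs_cost_sym (pairs_below E (2 * a)).
  have h1 := linked_trans (linked_sym sy (linked_N01 l)) (linked_sym sy le).
  have h2 := linked_trans (linked_sym sy (F_near eF)) (F_near e'F).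
  apply: linked_transW (linked_trans h1 h2) (linked_trans le' lz) _.
  have : 3 * Q%:R * t * a <= 2 ^+ s * a by rewrite ler_pM2r.
  have : t * a <= Q%:R * t * a.
    by rewrite -mulrA ler_peMl ?ler1n // mulr_ge0 ?ltW ?t_gt0.
  have : (4 + r) * a <= t * a.
    by rewrite ler_pM2r //; have := r_le; have := t_ge256; lra.
  have : 0 <= r * a by rewrite mulr_ge0 ?ltW //; have := r_ge4; lra.
  lra.
have small0 : 0 < vol (ball_set N0 x a).
  apply: lt_le_trans (vol_ball_ge _ _ _ _) => //; first exact: ltW.
  by apply: le_trans (ltW taM); have := a_gt0; have := t_ge256; nra.
have U0 : 0 < vol U.
  apply: lt_le_trans (beta_vol_gt0 y) (volS _).
  exact: (finset.bigcup_sup y).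
apply: lerB; rewrite ler_ln ?posrE //.
- exact: volS.
- by apply: lt_le_trans U0 (volS big).
- exact: volS.
Qed.

(** Each [sigma y] has measure at least [r / 4 * a], and the divergence bound applied to the volumes
    of the [beta y] gives a total gain of [r / 4 * a * #|N| * ln #|N|]. Conversely [t = 32 * b * r],
    where [b] is at most [6 * ln #|N|] and [#|F|] at most [2 * #|N|]; hence
    [1536 = 4 * 32 * 6 * 2]. *)
Lemma core_region_gain :
  t * a * #|F|%:R <= 1536 * \sum_(x in Y) nu x * gain a x.
Proof.
have K0 : 0 < #|N|%:R :> R by rewrite ltr0n ltnW.
have step : r / 4 * a * (#|N|%:R * ln (#|N|%:R : R)) <=
    \sum_(x in Y) nu x * gain a x.
  rewrite /Y sum_bigcup_disjoint; last first.
    move=> i j x iN jN xi xj.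
    by apply: (@beta_disjoint i j x) => //; apply: (fintype.subsetP (sigma_beta _)).
  have ra0 : 0 <= r / 4 * a by have := a_gt0; have := r_ge4; nra.
  apply: le_trans (ler_wpM2l ra0 (@le_sum_ln_ratio R V N (vol \o beta) _)) _.
    by move=> y _; apply: beta_vol_gt0.
  rewrite /= -volU mulr_sumr; apply: ler_sum => y yN.
  have ge0 : 0 <= ln (vol U) - ln (vol (beta y)).
    rewrite subr_ge0 ler_ln ?posrE //; first exact/volS/(finset.bigcup_sup y).
    apply: lt_le_trans (beta_vol_gt0 y) (volS _); exact: (finset.bigcup_sup y).
  apply: le_trans (ler_wpM2r ge0 (sigma_vol y)) _.
  rewrite /vol mulr_suml; apply: ler_sum => x xs.
  by rewrite ler_wpM2l // gain_ge.
have lnK : ln 2 <= ln (#|N|%:R : R) by rewrite ler_ln ?posrE // ler_nat.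
have ln2 := ln2_ge_half R.
(* From [2 ^ b.-1 <= 2 * #|N|] one gets [b * ln 2 <= 2 * ln 2 + ln #|N|], and [ln 2 <= ln #|N|]. *)
have bln : b%:R * ln 2 <= 3 * ln (#|N|%:R : R).
  have : (2 ^ b.-1 <= 2 * #|N|)%N.
    by case/andP: b_bounds => h _; apply: leq_trans net_card.
  rewrite -(ler_nat R) natrX natrM => le2.
  have : ln (2 ^+ b.-1) <= ln (2 * #|N|%:R : R).
    by rewrite ler_ln ?posrE ?exprn_gt0 ?mulr_gt0.
  rewrite lnXn // lnM ?posrE // -[leLHS]mulr_natr.
  have -> : b%:R = b.-1%:R + 1 :> R by rewrite natr1.
  by rewrite mulrDl; lra.
have leF : #|F|%:R <= 2 * #|N|%:R :> R by rewrite -natrM ler_nat net_card.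
suff le : t * a * #|F|%:R <= 1536 * (r / 4 * a * (#|N|%:R * ln (#|N|%:R : R))).
  by move: le step => {}le {}step; lra.
have -> : t * a * #|F|%:R = r * a * (32 * (b%:R * #|F|%:R)) by rewrite -br; ring.
set K := _ * ln _; have -> : 1536 * (r / 4 * a * K) = r * a * (32 * (12 * K)) by field.
rewrite /K {K}.
rewrite ler_pM2l; last by rewrite mulr_gt0 //; have := r_ge4; lra.
rewrite ler_pM2l //.
have bF : b%:R * #|F|%:R <= b%:R * (2 * #|N|%:R) :> R by rewrite ler_pM2l.
apply: le_trans bF _.
have bb : b%:R <= 6 * ln (#|N|%:R : R).
  have : b%:R * (1 / 2) <= b%:R * ln 2 :> R by rewrite ler_pM2l.
  by move: bln; lra.
have -> : 12 * (#|N|%:R * ln #|N|%:R) = 2 * #|N|%:R * (6 * ln (#|N|%:R : R)) by ring.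
by rewrite mulrC ler_pM2l // mulr_gt0.
Qed.

End SeparatedNet.

Lemma core_region : exists Y : {set V},
  (forall x, x \in Y -> exists2 e, e \in F & linked N1 e.1 x (t / 4 * a)) /\
  t * a * #|F|%:R <= 1536 * \sum_(x in Y) nu x * gain a x.
Proof.
have ra0 : 0 <= r * a by have := a_gt0; have := r_ge4; nra.
have [N [NP sep cov]] :=
  separated_net P ra0 (@pairs_cost_sym (pairs_below E a)).
have /choice[c cP] : forall x, exists y, x \in P ->
    y \in N /\ linked N0 x y (r * a).
  move=> x; have [/cov[y yN l]|xP] := pselect (x \in P); first by exists y.
  by exists x => /xP.
exists (\bigcup_(y in N) ball_set N0 y (r / 4 * a))%SET; split.
  exact: core_region_near NP.
exact: core_region_gain NP sep cP.
Qed.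

End Core.

(* Carves the pairs into far apart clusters of [N1]-radius [Q * t * a]: by
   doubling, one can stop at a radius whose outer shell of width [t * a]
   contains no more pairs than the cluster itself. *)
Lemma scale_region (F : {set V * V}) : F \subset E ->
  (forall e, e \in F -> a <= d e.1 e.2 < 2 * a) -> (#|F| <= 2 ^ Q)%N ->
  exists Y : {set V},
    (forall x, x \in Y -> exists2 e, e \in F & linked N1 e.1 x (t / 4 * a)) /\
    t * a * #|F|%:R <= 3072 * \sum_(x in Y) nu x * gain a x.
Proof.
move: {2}#|F| (leqnn #|F|) => n; elim: n F => [|n IH] F leF FE Fa FQ.
  exists finset.set0; split=> [x|]; first by rewrite inE.
  by rewrite big_set0 mulr0; move: leF; rewrite leqn0 => /eqP->; rewrite mulr0.
have [F0|[e0 e0F]] := set_0Vmem F.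
  exists finset.set0; split=> [x|]; first by rewrite inE.
  by rewrite big_set0 F0 cards0 !mulr0.
have ta0 : 0 < t * a by rewrite mulr_gt0 ?t_gt0.
pose Fin j := [set e in F | e.1 \in ball_set N1 e0.1 (j%:R * t * a)]%SET.
have FinF j : Fin j \subset F by apply/fintype.subsetP => e; rewrite inE => /andP[].
have [|j|j jQ dbl] := @exists_non_doubling (fun j => #|Fin j|) Q.
- apply/card_gt0P; exists e0; rewrite inE e0F /=; apply/ball_setP.
  by apply: linked_refl; rewrite !mul0r.
- exact: leq_trans (subset_leq_card (FinF j)) FQ.
have [||||e|Y1 [near1 gain1]] := @core_region (Fin j) e0.1.
- exact: fintype.subset_trans (FinF j) FE.
- by move=> e; rewrite inE => /andP[/Fa].
- apply/card_gt0P; exists e0; rewrite inE e0F /=; apply/ball_setP.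
  by apply: linked_refl; rewrite -mulrA mulr_ge0 // ltW.
- exact: leq_trans (subset_leq_card (FinF j)) FQ.
- rewrite inE => /andP[_ /ball_setP]; apply: linkedW.
  by rewrite -!mulrA ler_pM2r // ler_nat.
have [||||Y2 [near2 gain2]] := IH (F :\: Fin j.+1)%SET.
- have e0in : [set e0]%SET \subset Fin j.+1.
    rewrite finset.sub1set inE e0F /=; apply/ball_setP.
    by apply: linked_refl; rewrite -mulrA mulr_ge0 // ltW.
  apply: leq_trans (subset_leq_card (finset.setDS F e0in)) _.
  by move: leF; rewrite (cardsD1 e0 F) e0F.
- exact: fintype.subset_trans (finset.subsetDl _ _) FE.
- by move=> e /finset.setDP[/Fa].
- exact: leq_trans (subset_leq_card (finset.subsetDl _ _)) FQ.
exists (Y1 :|: Y2)%SET; split.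
  move=> x; rewrite inE => /orP[/near1[e eF l]|/near2[e eF l]]; exists e => //.
    exact: (fintype.subsetP (FinF j)).
  by case/finset.setDP: eF.
(* A common point would put a pair left outside within [(j + 1 / 2) * t * a] of the centre, hence
   into [Fin j.+1]. *)
have dis x : x \in Y1 -> x \notin Y2.
  case/near1 => e; rewrite inE => /andP[_ /ball_setP l0] l1.
  apply/negP => /near2[e' /finset.setDP[e'F /negP nF] l2]; apply: nF.
  rewrite inE e'F; apply/ball_setP.
  have sy := @pairs_cost_sym (pairs_below E (2 * a)).
  apply: linked_transW (linked_trans l0 l1) (linked_sym sy l2) _.
  by rewrite -[j.+1%:R]natr1; move: ta0; lra.
have -> : \sum_(x in (Y1 :|: Y2)%SET) nu x * gain a x =
    \sum_(x in Y1) nu x * gain a x + \sum_(x in Y2) nu x * gain a x.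
  rewrite (bigID (mem Y1)) /=; congr (_ + _); apply: eq_bigl => x.
    by rewrite inE; case: (x \in Y1); rewrite ?andbF ?andbT.
  rewrite inE; have := dis x; case: (x \in Y1) => [/(_ isT)/negbTE->|] //=.
  by rewrite andbT.
rewrite mulrDr.
(* Dropping the pairs of the shell costs the factor 2 between 1536 and 3072. *)
have cF : #|F|%:R <= 2 * #|Fin j|%:R + #|F :\: Fin j.+1|%:R :> R.
  rewrite -natrM -natrD ler_nat -(cardsID (Fin j.+1) F) leq_add2r.
  by apply: leq_trans dbl; apply/subset_leq_card/finset.subsetIr.
have := ler_wpM2l (ltW ta0) cF; rewrite mulrDr; lra.
Qed.

End Scale.

(** * Summation over dyadic scales *)

Hypothesis cardE : (#|E| <= 2 ^ Q)%N.

Lemma ln_vol_mono a0 a b x : 0 < a0 -> a0 <= M -> a0 <= a -> a <= b ->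
  ln a0 <= ln_vol a x <= ln M /\ ln_vol a x <= ln_vol b x.
Proof.
move=> a00 a0M a0a ab.
have sub u v : u <= v ->
    vol (ball_set (pairs_cost (pairs_below E u)) x u) <=
    vol (ball_set (pairs_cost (pairs_below E v)) x v).
  move=> uv; apply: volS; apply/fintype.subsetP => y /ball_setP l.
  by apply/ball_setP; apply: linkedW uv (linked_pairs_mono (pairs_belowS _ uv) l).
have ge0 : a0 <= vol (ball_set (pairs_cost (pairs_below E a0)) x a0).
  by apply: vol_ball_ge => //; apply: ltW.
have gea := le_trans ge0 (sub _ _ a0a).
have geb := le_trans gea (sub _ _ ab).
have [a_0 b_0] := (lt_le_trans a00 gea, lt_le_trans a00 geb).
rewrite /ln_vol !ler_ln ?posrE ?(lt_le_trans a00) // gea sub //.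
by rewrite vol_le.
Qed.

(** A pair at this scale weighs less than [2 * a], which doubles the constant 3072; gains are
    nonnegative, so the region may be enlarged to all of [V]. *)
Lemma scale_weight a : 0 < a -> a <= M ->
  \sum_(e in E | a <= d e.1 e.2 < 2 * a) d e.1 e.2 <=
  6144 / t * \sum_x nu x * gain a x.
Proof.
move=> a0 aM; pose F := [set e in E | a <= d e.1 e.2 < 2 * a]%SET.
have FE : F \subset E by apply/fintype.subsetP => e; rewrite inE => /andP[].
have Fa e : e \in F -> a <= d e.1 e.2 < 2 * a by rewrite inE => /andP[].
have [Y [_ leY]] := scale_region a0 FE Fa (leq_trans (subset_leq_card FE) cardE).
have s1 : a <= 2 ^+ s * a by apply: ler_peMl; [exact: ltW|rewrite exprn_ege1 // ler1n].
have le1 : \sum_(x in Y) nu x * gain a x <= \sum_x nu x * gain a x.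
  rewrite [leRHS](bigID (mem Y)) /= lerDl sumr_ge0 // => x _.
  by rewrite mulr_ge0 // subr_ge0; have [] := ln_vol_mono x a0 aM (lexx a) s1.
rewrite (eq_bigl (mem F)); last by move=> e; rewrite !inE.
have le2 : \sum_(e in F) d e.1 e.2 <= 2 * a * #|F|%:R.
  rewrite mulr_natr -sumr_const; apply: ler_sum => e /Fa/andP[_ /ltW //].
apply: le_trans le2 _; rewrite -(ler_pM2l t_gt0) mulrA.
rewrite [leRHS]mulrA [t * (_ / _)]mulrC divfK ?gt_eqF ?t_gt0 //; lra.
Qed.

(** A difference over [k] steps splits into [k] unit differences, and each of the resulting [k] sums
    telescopes. *)
Lemma sum_shift_le (L : nat -> R) (lo hi : R) n k :
  (forall i, lo <= L i <= hi) ->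
  \sum_(i < n) (L (i + k)%N - L i) <= k%:R * (hi - lo).
Proof.
move=> Lb; elim: k => [|k IH].
  by rewrite mul0r big1 // => i _; rewrite addn0 subrr.
rewrite (eq_bigr (fun i : 'I_n =>
  (L (i + k)%N - L i) + (L (i + k.+1)%N - L (i + k)%N))); last by move=> i _; lra.
rewrite big_split /= -natr1 mulrDl mul1r lerD //.
rewrite -(big_mkord xpredT (fun i => L (i + k.+1)%N - L (i + k)%N)).
under eq_bigr do rewrite addnS -addSn.
rewrite (telescope_sumr (fun i => L (i + k)%N)) //.
by have /andP[] := Lb (n + k)%N; have /andP[] := Lb (0 + k)%N; lra.
Qed.

Theorem light_pairs :
  \sum_(e in E) d e.1 e.2 <= M * (1 + 6144 * s%:R * Q%:R / t).
Proof.
have t0 := t_gt0.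
have [->|[e1 e1E]] := set_0Vmem E.
  rewrite big_set0; apply: mulr_ge0; first by rewrite M_def sumr_ge0.
  apply: addr_ge0; first exact: ler01.
  apply: divr_ge0 (ltW t0).
  exact: mulr_ge0 (mulr_ge0 (ler0n R 6144) (ler0n R s)) (ler0n R Q).
have M0 : 0 < M.
  by apply: le_lt_trans (pair_lt_M e1E); rewrite mulr_ge0 ?d_ge0 // ltW.
(* The at most [2 ^ Q] pairs shorter than [a0] weigh at most [M] together; [Q] dyadic scales cover
   the range from [a0] to [M]. *)
pose a0 := M / 2 ^+ Q.
have q0 : 0 < 2 ^+ Q :> R by rewrite exprn_gt0.
have a00 : 0 < a0 by rewrite divr_gt0.
have Ma0 : 2 ^+ Q * a0 = M by rewrite /a0 mulrC divfK // gt_eqF.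
have ge_a0 i : a0 <= 2 ^+ i * a0.
  by apply: ler_peMl; [exact: ltW|rewrite exprn_ege1 // ler1n].
have a0M : a0 <= M by rewrite -Ma0.
have dyadic n c : c < 2 ^+ n * a0 ->
    c <= a0 + \sum_(i < n | 2 ^+ i * a0 <= c < 2 * (2 ^+ i * a0)) c.
  elim: n => [|n IH] ltc.
    by rewrite big_ord0 addr0; move: ltc; rewrite expr0 mul1r => /ltW.
  rewrite big_mkcond big_ord_recr /= -big_mkcond /=.
  have [/IH le|le] := ltP c (2 ^+ n * a0); first by rewrite addr0.
  rewrite mulrA -exprS ltc /= addrA lerDr addr_ge0 ?(ltW a00) // sumr_ge0 // => i _.
  by apply: le_trans le; rewrite mulr_ge0 ?exprn_ge0 ?ltW.
have lt_top e : e \in E -> d e.1 e.2 < 2 ^+ Q * a0.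
  move=> /pair_lt_M; rewrite Ma0; apply: le_lt_trans.
  by rewrite ler_peMl ?d_ge0 //; have := t_ge256; lra.
apply: (@le_trans _ _ (\sum_(e in E) (a0 +
    \sum_(i < Q | 2 ^+ i * a0 <= d e.1 e.2 < 2 * (2 ^+ i * a0)) d e.1 e.2))).
  by apply: ler_sum => e eE; apply/dyadic/lt_top.
rewrite big_split /= sumr_const mulrDr mulr1 lerD //.
  rewrite -mulr_natl -Ma0 ler_pM2r // -natrX ler_nat //.
rewrite (exchange_big_dep xpredT) //=.
(* The shift is [s] and [ln_vol] ranges over an interval of length [ln M - ln a0 = Q * ln 2], at
   most [Q]. *)
have gains x : \sum_(i < Q) gain (2 ^+ i * a0) x <= s%:R * Q%:R.
  pose L i := ln_vol (2 ^+ i * a0) x.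
  rewrite (eq_bigr (fun i : 'I_Q => L (i + s)%N - L i)); last first.
    by move=> i _; rewrite /gain /L mulrA -exprD addnC.
  have Lb i : ln a0 <= L i <= ln M.
    by have [] := ln_vol_mono x a00 a0M (ge_a0 i) (lexx _).
  apply: le_trans (sum_shift_le Q s Lb) _; rewrite ler_wpM2l //.
  rewrite -Ma0 lnM ?posrE // addrK lnXn // -[leLHS]mulr_natl ler_piMr //.
  by have := @le_ln1Dx R 1; rewrite -[1 + 1]/2; apply; lra.
apply: (@le_trans _ _ (\sum_(i < Q) 6144 / t * \sum_x nu x * gain (2 ^+ i * a0) x)).
  apply: ler_sum => i _; apply: scale_weight.
    by rewrite mulr_gt0 ?exprn_gt0.
  by rewrite -[leRHS]Ma0 ler_pM2r // ler_eXn2l ?ltr1n // ltnW.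
rewrite -mulr_sumr exchange_big /=.
rewrite (_ : M * _ = 6144 / t * (M * (s%:R * Q%:R))); last by ring.
apply: ler_wpM2l (divr_ge0 (ler0n R 6144) (ltW t0)) _ _ _.
rewrite {1}M_def mulr_suml.
by apply: ler_sum => x _; rewrite -mulr_sumr ler_wpM2l.
Qed.

End LightPairs.

(** * Greedy constructions *)

Lemma exists_max (R : realType) (I : finType) (P : {set I}) (f : I -> R) i0 :
  i0 \in P -> exists2 i, i \in P & forall j, j \in P -> f j <= f i.
Proof.
move=> i0P; case: (@arg_maxP _ _ I i0 (mem P) f i0P) => i iP le.
by exists i => // j /le.
Qed.

Section Greedy.
Variables (R : realType) (V : finType) (C0 : V -> V -> R -> Prop).
Hypothesis C0_ge0 : cost_ge0 C0.
Hypothesis C0_sym : cost_sym C0.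

(** The pairs are treated in order of increasing length: the induction sets a longest pair [f] aside
    and adds it only if the others do not yet span it. *)
Lemma greedy_pairs (d : V -> V -> R) (t : R) (P : {set V * V}) :
  (forall x y, 0 <= d x y) -> (forall x y, d x y = d y x) -> 1 <= t ->
  exists E : {set V * V}, [/\ E \subset P,
    forall e, e \in P -> linked (pairs_cost C0 d E) e.1 e.2 (t * d e.1 e.2) &
    girth_gt C0 d t E].
Proof.
move=> d_ge0 d_sym t1; have t0 : 0 <= t := le_trans ler01 t1.
move: {2}#|P| (leqnn #|P|) => n; elim: n P => [|n IH] P leP.
  exists finset.set0; split=> [|e|e]; rewrite ?finset.sub0set ?inE //.
  by move: leP; rewrite leqn0 cards_eq0 => /eqP ->; rewrite inE.
have [P0|[f0 f0P]] := set_0Vmem P.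
  by exists finset.set0; split=> [|e|e]; rewrite ?finset.sub0set ?P0 ?inE.
have [f fP fmax] := exists_max (fun e : V * V => d e.1 e.2) f0P.
have [|E [EP cov girth]] := IH (P :\ f)%SET.
  by move: leP; rewrite (cardsD1 f P) fP.
have EP' : E \subset P := fintype.subset_trans EP (finset.subsetDl _ _).
have [lf|nlf] := pselect (linked (pairs_cost C0 d E) f.1 f.2 (t * d f.1 f.2)).
  exists E; split=> // e eP; have [->//|neq] := eqVneq e f.
  by apply: cov; rewrite !inE neq.
have fE : f \notin E by apply/negP => /(fintype.subsetP EP); rewrite !inE eqxx.
exists (f |: E)%SET; split.
- by rewrite finset.subUset finset.sub1set fP.
- move=> e eP; have [->|neq] := eqVneq e f.
    apply: linkedW (linked_pair _ _ (F := (f |: E)%SET) _); last by rewrite !inE eqxx.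
    by rewrite ler_peMl.
  apply: linked_pairs_mono (finset.subsetUr _ _) _.
  by apply: cov; rewrite !inE neq.
- move=> e; rewrite !inE => /predU1P[->|eE] l.
    by apply: nlf; rewrite finset.setU1K in l.
  have sy := @pairs_cost_sym R V C0 d C0_sym d_sym.
  have avoid_f x y c : pairs_cost C0 d ((f |: E) :\ e)%SET x y c ->
      pairs_cost C0 d (E :\ e)%SET x y c \/
      c = d f.1 f.2 /\ ((x = f.1 /\ y = f.2) \/ (x = f.2 /\ y = f.1)).
    case=> [h|[h ->]]; first by left; left.
    rewrite !inE in h; case: h => /andP[ne /orP[/eqP <-|h]] /=.
    + by right; split=> //; left.
    + by left; right; split=> //; left; rewrite !inE ne.
    + by right; split; [rewrite d_sym|right].
    + by left; right; split=> //; right; rewrite !inE ne.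
  (* A short detour around [e] must use [f]. Replacing [f] by the no longer [e] in this cycle gives
     a short detour around [f], which was excluded. *)
  have [/girth|] := linked_add_edge (d_ge0 f.1 f.2)
    (@pairs_cost_ge0 _ _ _ _ C0_ge0 d_ge0 _) avoid_f l; first exact.
  move=> [b1 [b2 [le_b H]]]; apply: nlf.
  have def : d e.1 e.2 <= d f.1 f.2 by apply: fmax; apply: (fintype.subsetP EP').
  have tdef : t * d e.1 e.2 <= t * d f.1 f.2 by rewrite ler_wpM2l.
  have le := linked_pair C0 d eE.
  have mono := linked_pairs_mono (finset.subsetDl E [set e]%SET).
  case: H => -[/mono l1 /mono l2].
    apply: linked_transW (linked_trans (linked_sym (sy _) l1) le)
      (linked_sym (sy _) l2) _.
    lra.
  apply: linked_transW (linked_trans l2 (linked_sym (sy _) le)) l1 _.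
  lra.
Qed.

(** Greedy choice in order of increasing [D], which will be the distance to the terminals. *)
Lemma packing (D : V -> R) (X : {set V}) : (forall x, 0 <= D x) ->
  exists A : {set V}, [/\ A \subset X,
    forall v, v \in X -> exists2 u, u \in A & D u <= D v /\ linked C0 u v (3 * D v) &
    forall u v, u \in A -> v \in A -> u != v -> ~ linked C0 u v (3 * D v)].
Proof.
move=> D0; move: {2}#|X| (leqnn #|X|) => n; elim: n X => [|n IH] X leX.
  exists finset.set0; split=> [|v|u v]; rewrite ?finset.sub0set ?inE //.
  by move: leX; rewrite leqn0 cards_eq0 => /eqP ->; rewrite inE.
have [X0|[x0 x0X]] := set_0Vmem X.
  by exists finset.set0; split=> [|v|u v]; rewrite ?finset.sub0set ?X0 ?inE.
have [x xX xmax] := exists_max D x0X.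
have [|A [AX cov sep]] := IH (X :\ x)%SET.
  by move: leX; rewrite (cardsD1 x X) xX.
have AX' : A \subset X := fintype.subset_trans AX (finset.subsetDl _ _).
have Dx u : u \in A -> D u <= D x by move=> /(fintype.subsetP AX')/xmax.
have [[u uA lu]|no] := pselect (exists2 u, u \in A & linked C0 u x (3 * D x)).
  exists A; split=> // v vX; have [->|neq] := eqVneq v x.
    by exists u; rewrite // Dx.
  by apply: cov; rewrite !inE neq.
exists (x |: A)%SET; split.
- by rewrite finset.subUset finset.sub1set xX.
- move=> v vX; have [->|neq] := eqVneq v x.
    exists x; first by rewrite !inE eqxx.
    by split=> //; apply: linked_refl; rewrite mulr_ge0.
  have [|u uA h] := cov v; first by rewrite !inE neq.
  by exists u => //; rewrite !inE uA orbT.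
- move=> u v; rewrite !inE => /predU1P[->|uA] /predU1P[->|vA].
  + by rewrite eqxx.
  + move=> _ l; apply: no; exists v => //; apply: linkedW (linked_sym C0_sym l).
    by rewrite ler_pM2l // Dx.
  + by move=> _ l; apply: no; exists u.
  + exact: sep.
Qed.

(** The balls of radius [D v] around the packed vertices are disjoint, and each has measure at least
    [D v] because it misses a vertex. *)
Lemma packing_weight (nu : V -> R) (D : V -> R) (A : {set V}) :
  (forall x, 0 <= nu x) -> (forall x, 0 <= D x) ->
  (forall x y a, 0 <= a -> ~ linked C0 x y a -> a < vol nu (ball_set C0 x a)) ->
  (forall v, v \in A -> exists y, ~ linked C0 v y (3 * D v)) ->
  (forall u v, u \in A -> v \in A -> u != v -> ~ linked C0 u v (3 * D v)) ->
  \sum_(v in A) D v <= \sum_x nu x.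
Proof.
move=> nu0 D0 low out sep.
have dis u v x : u \in A -> v \in A ->
    x \in ball_set C0 u (D u) -> x \in ball_set C0 v (D v) -> u = v.
  move=> uA vA /ball_setP lu /ball_setP lv; apply/eqP; apply: contraT => neq.
  have [le|/ltW le] := leP (D u) (D v).
    case: (sep u v uA vA neq).
    by apply: linked_transW lu (linked_sym C0_sym lv) _; have := D0 v; lra.
  rewrite eq_sym in neq; case: (sep v u vA uA neq).
  by apply: linked_transW lv (linked_sym C0_sym lu) _; have := D0 u; lra.
apply: (@le_trans _ _ (\sum_(v in A) vol nu (ball_set C0 v (D v)))).
  apply: ler_sum => v /out[y ny]; apply/ltW/(low v y) => // l; apply: ny.
  by apply: linkedW l; have := D0 v; lra.
rewrite /vol -(sum_bigcup_disjoint _ dis).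
rewrite [leRHS](bigID (mem (\bigcup_(v in A) ball_set C0 v (D v))%SET)).
by rewrite /= lerDl sumr_ge0.
Qed.

End Greedy.

(** * Weighted edge sets *)

Lemma sum_setU_le (R : realType) (T : finType) (A B : {set T}) (g : T -> R) :
  (forall x, 0 <= g x) ->
  \sum_(x in (A :|: B)%SET) g x <= \sum_(x in A) g x + \sum_(x in B) g x.
Proof.
move=> g0; rewrite (bigID (mem A)) /= lerD //.
  rewrite (eq_bigl (fun x => x \in A)) // => x.
  by rewrite inE; case: (x \in A); rewrite ?andbF ?andbT.
rewrite [leRHS](bigID (mem A)) /= -[leLHS]add0r lerD ?sumr_ge0 //.
rewrite (eq_bigl (fun x => (x \in B) && (x \notin A))) // => x.
by rewrite inE; case: (x \in A); rewrite ?andbF ?andbT.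
Qed.

Lemma sum_bigcup_le (R : realType) (I T : finType) (P : {set I})
    (A : I -> {set T}) (g : T -> R) : (forall x, 0 <= g x) ->
  \sum_(x in (\bigcup_(i in P) A i)%SET) g x <= \sum_(i in P) \sum_(x in A i) g x.
Proof.
move=> g0; apply: (big_rec2 (fun (S : {set T}) r => \sum_(x in S) g x <= r)).
  by rewrite big_set0.
by move=> i S r _ le; apply: le_trans (sum_setU_le _ _ g0) _; rewrite lerD2l.
Qed.

Section EdgeCost.
Variables (R : realType) (V : finType) (w : {set V} -> R).
Hypothesis w_ge0 : forall e, 0 <= w e.
Implicit Types (D S T : {set {set V}}).

Definition edge_cost D (x y : V) (c : R) : Prop :=
  [set x; y]%SET \in D /\ c = w [set x; y]%SET.

Definition walk_cost (u : V) (p : seq V) : R :=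
  \sum_(xy <- zip (u :: p) p) w [set xy.1; xy.2]%SET.

Lemma edge_cost_ge0 D : cost_ge0 (edge_cost D).
Proof. by move=> x y c [_ ->]. Qed.

Lemma edge_cost_sym D : cost_sym (edge_cost D).
Proof. by move=> x y c [h ->]; rewrite /edge_cost finset.setUC. Qed.

Lemma linked_edges_mono D D' x y b : D \subset D' ->
  linked (edge_cost D) x y b -> linked (edge_cost D') x y b.
Proof.
by move=> /fintype.subsetP sD; apply: linked_mono => u v c [/sD h ->].
Qed.

Lemma walk_cost_cons u v p :
  walk_cost u (v :: p) = w [set u; v]%SET + walk_cost v p.
Proof. by rewrite /walk_cost /= big_cons. Qed.

Lemma walk_cost_ge0 u p : 0 <= walk_cost u p.
Proof. by apply: sumr_ge0. Qed.

Lemma walk_cost_cat u p q :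
  walk_cost u (p ++ q) = walk_cost u p + walk_cost (last u p) q.
Proof.
elim: p u => [|v p IH] u /=; first by rewrite {2}/walk_cost big_nil add0r.
by rewrite !walk_cost_cons IH addrA.
Qed.

Lemma walk_linked D x p : path (adj D) x p ->
  linked (edge_cost D) x (last x p) (walk_cost x p).
Proof.
elim: p x => [|y p IH] x /=.
  by move=> _; apply: linked_refl; apply: walk_cost_ge0.
move=> /andP[xy /IH l]; rewrite walk_cost_cons.
exact: linked_trans (linked1 (conj xy erefl)) l.
Qed.

(** Loops are cut out, which does not increase the cost as weights are nonnegative. *)
Lemma linked_walk D x y b : linked (edge_cost D) x y b ->
  exists p, [/\ path (adj D) x p, last x p = y, uniq (x :: p) &
                walk_cost x p <= b].
Proof.
elim=> [{}x {}b b0|{}x {}y z c {}b [xy ->] _ [p [pp lp up cp]]].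
  by exists [::]; split=> //; rewrite /walk_cost big_nil.
have w0 := w_ge0 [set x; y]%SET.
have [xp|xp] := boolP (x \in y :: p); last first.
  exists (y :: p); split=> //=; first by rewrite pp andbT.
    by rewrite xp.
  by rewrite walk_cost_cons; lra.
move: xp; rewrite inE => /predU1P[xy'|xp].
  by exists p; rewrite xy'; split=> //; lra.
case/splitPr: xp pp lp up cp => p1 p2.
rewrite cat_path last_cat cons_uniq cat_uniq walk_cost_cat walk_cost_cons /=.
move=> /and3P[_ _ pp] lp /and3P[_ _ /andP[_ up]] cp; exists p2; split=> //.
have := walk_cost_ge0 y p1; have := w_ge0 [set last y p1; x]%SET; lra.
Qed.

Lemma linked_support D x y b : linked (edge_cost D) x y b ->
  exists S, [/\ S \subset D, \sum_(e in S) w e <= b & linked (edge_cost S) x y b].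
Proof.
elim=> [{}x {}b b0|{}x {}y z c {}b [xy ->] _ [S [SD wS l]]].
  exists finset.set0; split; rewrite ?finset.sub0set ?big_set0 //.
  exact: linked_refl.
exists ([set x; y]%SET |: S)%SET; split.
- by rewrite finset.subUset finset.sub1set xy.
- by apply: le_trans (sum_setU_le _ _ w_ge0) _; rewrite big_set1; lra.
- apply: (@linked_step _ _ _ x y z (w [set x; y]%SET)).
    by split; rewrite // !inE eqxx.
  exact: linked_edges_mono (finset.subsetUr _ _) l.
Qed.

(** Only simple walks matter; they are finitely many, so the minimum is attained. *)
Lemma exists_dist D : connected_edges D -> exists dst : V -> V -> R,
  forall x y, linked (edge_cost D) x y (dst x y) /\
    forall b, linked (edge_cost D) x y b -> dst x y <= b.
Proof.
move=> conn.
have /choice[f fP] : forall xy : V * V, exists m,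
    linked (edge_cost D) xy.1 xy.2 m /\
    forall b, linked (edge_cost D) xy.1 xy.2 b -> m <= b.
  case=> x y /=; have /connectP[p0 p0P yp0] := conn x y.
  have [p [pp lp up _]] := linked_walk (walk_linked p0P).
  have bounded q : uniq (x :: q) -> (size q <= #|V|)%N.
    by move=> /card_uniqP uq; have := max_card (mem (x :: q)); rewrite uq => /ltnW.
  pose ok (q : #|V|.-bseq V) := path (adj D) x q && (last x q == y).
  have okp : ok (Bseq (bounded p up)) by rewrite /ok /= pp lp -yp0 eqxx.
  case: (@arg_minP _ _ _ _ ok (fun q : #|V|.-bseq V => walk_cost x q) okp).
  move=> q /andP[qp /eqP lq] qmin; exists (walk_cost x q); split.
    by rewrite -lq; apply: walk_linked.
  move=> b /linked_walk[q' [pq' lq' uq' cq']]; apply: le_trans cq'.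
  by apply: (qmin (Bseq (bounded q' uq'))); rewrite /ok /= pq' lq' eqxx.
by exists (fun x y => f (x, y)) => x y; apply: (fP (x, y)).
Qed.

Section TreeMeasure.
Variable T : {set {set V}}.

(* Each edge is charged at both of its endpoints, so that a walk leaving a
   ball contributes all its weight to the vertices inside of the ball. *)
Definition incident_weight (x : V) : R := \sum_(e in T | x \in e) w e.

Lemma incident_weight_ge0 x : 0 <= incident_weight x.
Proof. by apply: sumr_ge0. Qed.

Lemma sum_incident_weight : (forall e, e \in T -> #|e| = 2%N) ->
  \sum_x incident_weight x = 2 * \sum_(e in T) w e.
Proof.
move=> card2; rewrite /incident_weight (exchange_big_dep (mem T)) /=; last first.
  by move=> ? ? _ /andP[].
rewrite mulr_sumr; apply: eq_bigr => e eT.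
rewrite (eq_bigl (mem e)); last by move=> x; rewrite /= eT.
by rewrite sumr_const card2 // mulr_natl.
Qed.

(** Along a simple walk to [y], each vertex reached at cost at most [a] lies in the ball and pays
    for the next edge. Simplicity prevents a vertex from paying twice. *)
Lemma incident_ball_lower : connected_edges T -> forall x y (a : R), 0 <= a ->
  ~ linked (edge_cost T) x y a ->
  a < vol incident_weight (ball_set (edge_cost T) x a).
Proof.
move=> conn x y a a0 nl; set B := ball_set _ x a.
have nu0 := incident_weight_ge0.
have /connectP[p0 p0P yp0] := conn x y.
have [p [pp lp up _]] := linked_walk (walk_linked p0P); rewrite -yp0 in lp.
have walk z q c : path (adj T) z q -> linked (edge_cost T) x z c ->
    last z q = y -> a < c + \sum_(u <- z :: q | u \in B) incident_weight u.
  elim: q z c => [|z' q IH] z c /=.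
    move=> _ l zy; have [lt|le] := ltP a c.
      by apply: (lt_le_trans lt); rewrite lerDl sumr_ge0 // => i _; apply: nu0.
    by case: nl; rewrite -zy; apply: linkedW l.
  move=> /andP[zz' pq] l lq; have [lt|le] := ltP a c.
    by apply: (lt_le_trans lt); rewrite lerDl sumr_ge0 // => i _; apply: nu0.
  have zB : z \in B by apply/ball_setP; apply: linkedW l.
  have := IH z' _ pq (linked_trans l (linked1 (conj zz' erefl))) lq.
  rewrite [in X in _ -> X]big_cons zB => lt; apply: (lt_le_trans lt).
  rewrite -addrA lerD2l lerD2r /incident_weight (bigD1 [set z; z']%SET) /=.
    by rewrite lerDl sumr_ge0.
  by rewrite (zz' : [set z; z']%SET \in T) !inE eqxx.
have := walk x p 0 pp (linked_refl _ _ (lexx 0)) lp; rewrite add0r => lt.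
apply: (lt_le_trans lt).
rewrite -big_filter big_uniq ?filter_uniq //=.
rewrite /vol [leRHS](bigID (fun z => z \in [seq u <- x :: p | u \in B])) /=.
rewrite [X in _ <= X + _](eq_bigl (fun z => z \in [seq u <- x :: p | u \in B]));
  last first.
  by move=> u; rewrite mem_filter; case: (u \in B).
by rewrite lerDl sumr_ge0 // => i _; apply: incident_weight_ge0.
Qed.

End TreeMeasure.
End EdgeCost.

(** * Spanners for terminals *)

(** With [Q = 2 ^ p.+1] and [s = num_scales p], the stretch equals [2 ^ 13 * s * Q], which dominates
    the term [6144 * s * Q] of [light_pairs]. *)
Definition num_scales (p : nat) : nat := (4 * p + 32)%N.
Definition greedy_stretch (p : nat) : nat := (2 ^ (p + 14) * num_scales p)%N.

(** This is the hypothesis [s_ge]. The stretch itself depends on [s], but only linearly, so [s]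
    linear in [p] suffices. *)
Lemma scale_separation p :
  (3 * 2 ^ p.+1 * greedy_stretch p <= 2 ^ num_scales p)%N.
Proof.
have le : (p + 8 <= 2 ^ (p + 4))%N.
  by elim: p => // p IH; rewrite !addSn expnS; lia.
have le2 : (num_scales p <= 2 ^ (p + 6))%N.
  rewrite (_ : p + 6 = (p + 4) + 2)%N ?[(2 ^ (_ + 2))%N]expnD; last by lia.
  by rewrite /num_scales; lia.
apply: (@leq_trans (2 ^ 2 * 2 ^ p.+1 * (2 ^ (p + 14) * 2 ^ (p + 6)))%N).
  by rewrite leq_mul // ?leq_mul.
by rewrite -!expnD leq_exp2l // /num_scales; lia.
Qed.

Section TerminalSpanner.
Variables (R : realType) (V : finType) (w : {set V} -> R).
Variables (D T : {set {set V}}) (K : {set V}) (p : nat).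
Hypothesis w_ge0 : forall e, 0 <= w e.
Hypothesis TD : T \subset D.
Hypothesis card_T : forall e, e \in T -> #|e| = 2%N.
Hypothesis conn_T : connected_edges T.
Hypothesis K_gt0 : (0 < #|K|)%N.
Hypothesis K_le : (#|K| <= 2 ^ 2 ^ p)%N.

Lemma terminal_spanner : exists H : {set {set V}}, [/\ H \subset D,
  \sum_(e in H) w e <= 6 * \sum_(e in T) w e &
  forall u v b, u \in K -> linked (edge_cost w D) u v b ->
    linked (edge_cost w (H :|: T)%SET) u v
      ((5 * (greedy_stretch p)%:R + 4) * b)].
Proof.
set t : R := (greedy_stretch p)%:R.
set C0 := edge_cost w T.
have conn_D : connected_edges D.
  move=> x y; apply: connect_sub (conn_T x y) => u v uv.
  by apply: connect1; apply: (fintype.subsetP TD).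
have [d dP] := exists_dist w_ge0 conn_D.
have C0_ge0 : cost_ge0 C0 := @edge_cost_ge0 _ _ w w_ge0 T.
have C0_sym : cost_sym C0 := @edge_cost_sym _ _ w T.
have symD := @edge_cost_sym _ _ w D.
have d_ge0 x y : 0 <= d x y := linked_ge0 (@edge_cost_ge0 _ _ w w_ge0 D) (dP x y).1.
have d_le x y : d x y <= d y x by apply: (dP x y).2; apply: linked_sym (dP y x).1.
have d_sym x y : d x y = d y x by apply/le_anti; rewrite !d_le.
have /card_gt0P[k0 k0K] := K_gt0.
have /choice[kap kapP] : forall v, exists k,
    k \in K /\ forall k', k' \in K -> d k v <= d k' v.
  move=> v; have [k kK kmax] := exists_max (fun k => - d k v) k0K.
  by exists k; split=> // k' /kmax; rewrite lerN2.
pose Dist v := d (kap v) v.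
have Dist_ge0 v : 0 <= Dist v by apply: d_ge0.
have t1 : 1 <= t.
  by rewrite /t ler1n muln_gt0 expn_gt0 addn_gt0 orbT.
have [E [EK covE girthE]] := greedy_pairs C0_ge0 C0_sym (finset.setX K K) d_ge0 d_sym t1.
(* The vertices that [T] does not already link cheaply to a terminal; only these are packed. *)
pose far := [set v | `[< forall k, k \in K -> ~ linked C0 k v (3 * Dist v) >]]%SET.
have [A [AX covA sepA]] := packing C0_sym far Dist_ge0.
have nu0 := incident_weight_ge0 w_ge0 T.
have lower := incident_ball_lower w_ge0 conn_T.
have total := sum_incident_weight w card_T.
have /choice[S1 S1P] : forall e : V * V, exists S : {set {set V}},
    [/\ S \subset D, \sum_(f in S) w f <= d e.1 e.2 &
        linked (edge_cost w S) e.1 e.2 (d e.1 e.2)].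
  by move=> e; apply: linked_support w_ge0 _ _ _ _ (dP _ _).1.
have /choice[S2 S2P] : forall v : V, exists S : {set {set V}},
    [/\ S \subset D, \sum_(f in S) w f <= Dist v &
        linked (edge_cost w S) (kap v) v (Dist v)].
  by move=> v; apply: linked_support w_ge0 _ _ _ _ (dP _ _).1.
pose H1 := (\bigcup_(e in E) S1 e)%SET; pose H2 := (\bigcup_(v in A) S2 v)%SET.
exists (H1 :|: H2)%SET.
have HD : (H1 :|: H2)%SET \subset D.
  rewrite finset.subUset; apply/andP; split; apply/finset.bigcupsP => i _.
    by case: (S1P i).
  by case: (S2P i).
split=> //.
(* The factor 4 is [2 * 2]: the measure has mass [2 * w(T)], and [light_pairs] at most doubles
   it. *)
- have leE : \sum_(e in H1) w e <= 4 * \sum_(e in T) w e.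
    apply: le_trans (sum_bigcup_le _ _ w_ge0) _.
    apply: (@le_trans _ _ (\sum_(e in E) d e.1 e.2)).
      by apply: ler_sum => e _; case: (S1P e).
    pose Q := (2 ^ p.+1)%N; pose s := num_scales p.
    have t_def : greedy_stretch p = (2 ^ 13 * (s * Q))%N.
      rewrite /greedy_stretch -/s (_ : p + 14 = 13 + p.+1)%N ?expnD -/Q; last by lia.
      by rewrite -mulnA [(Q * s)%N]mulnC.
    have cardE : (#|E| <= 2 ^ Q)%N.
      apply: leq_trans (subset_leq_card EK) _.
      by rewrite cardsX /Q expnS mul2n -addnn expnD leq_mul.
    have tQ : 128 * Q.+1%:R <= t.
      rewrite /t t_def -[128%:R]/((2 ^ 7)%:R) -natrM ler_nat.
      rewrite (expnD 2 7 6) -mulnA leq_pmul2l ?expn_gt0 //.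
      have : (0 < Q)%N by rewrite expn_gt0.
      by rewrite /s /num_scales (_ : 2 ^ 6 = 64)%N //; nia.
    have ts : 3 * Q%:R * t <= 2 ^+ s :> R.
      by rewrite -natrX -!natrM ler_nat scale_separation.
    have Q0 : (0 < Q)%N by rewrite expn_gt0.
    have := light_pairs C0_sym d_ge0 d_sym nu0 erefl lower girthE tQ ts Q0 cardE.
    move=> /le_trans; apply; rewrite total.
    have t0 : 0 < t := lt_le_trans ltr01 t1.
    have : 6144 * s%:R * Q%:R / t <= 1.
      rewrite ler_pdivrMr // mul1r -mulrA /t t_def natrM natrM natrX.
      by rewrite ler_wpM2r ?mulr_ge0 ?ler0n // !exprS expr0; lra.
    have : 0 <= \sum_(e in T) w e by apply: sumr_ge0.
    set q := _ / t; set W := \sum_(e in T) _ => W0 q1.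
    have : W * q <= W by rewrite ler_piMr.
    by lra.
  have leA : \sum_(e in H2) w e <= 2 * \sum_(e in T) w e.
    apply: le_trans (sum_bigcup_le _ _ w_ge0) _.
    apply: (@le_trans _ _ (\sum_(v in A) Dist v)).
      by apply: ler_sum => v _; case: (S2P v).
    rewrite -total.
    apply: (packing_weight C0_sym nu0 Dist_ge0 lower _ sepA) => v vA; exists k0 => l.
    have := fintype.subsetP AX v vA; rewrite inE => /asboolP/(_ k0 k0K) nl.
    by apply: nl; apply: linked_sym l.
  by apply: le_trans (sum_setU_le _ _ w_ge0) _; lra.
- move=> u v b uK luv; set HT := (_ :|: T)%SET.
  have symHT := @edge_cost_sym _ _ w HT.
  have subT : T \subset HT by apply: finset.subsetUr.
  have pairs x y c : linked (pairs_cost C0 d E) x y c -> linked (edge_cost w HT) x y c.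
    have := @linked_lift _ _ (pairs_cost C0 d E) (edge_cost w HT) 1 x y c ler01.
    rewrite mul1r; apply => {}x {}y {}c; rewrite mul1r.
    have S1HT e : e \in E -> linked (edge_cost w HT) e.1 e.2 (d e.1 e.2).
      move=> eE; have [_ _] := S1P e; apply: linked_edges_mono.
      apply: fintype.subset_trans (finset.subsetUl _ _).
      apply: fintype.subset_trans (finset.subsetUl _ _).
      exact: (finset.bigcup_sup e).
    case=> [h|[[/S1HT h|/S1HT h] -> //]].
      by apply: linked_edges_mono subT (linked1 h).
    by rewrite d_sym; apply: linked_sym h.
  (* A far vertex goes through [T] to a packed vertex at cost [3 * Dist v], then along a shortest
     path to a terminal at cost at most [Dist v]. *)
  have [k kK lk] : exists2 k, k \in K & linked (edge_cost w HT) k v (4 * Dist v).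
    have [vX|] := boolP (v \in far); last first.
      rewrite inE => /asboolP/existsNP[k /not_implyP[kK /contrapT l]].
      exists k => //; apply: linkedW (linked_edges_mono subT l).
      by have := Dist_ge0 v; lra.
    have [x xA [leD l]] := covA v vX; exists (kap x); first by case: (kapP x).
    have l2 : linked (edge_cost w HT) (kap x) x (Dist x).
      have [_ _] := S2P x; apply: linked_edges_mono.
      apply: fintype.subset_trans (finset.subsetUl _ _).
      apply: fintype.subset_trans (finset.subsetUr _ _).
      exact: (finset.bigcup_sup x).
    by apply: linked_transW l2 (linked_edges_mono subT l) _; lra.
  have Db : Dist v <= b by apply: le_trans ((kapP v).2 u uK) ((dP u v).2 b luv).
  have lk' : linked (edge_cost w HT) k v (4 * b) by apply: linkedW lk; lra.
  have HTD : HT \subset D by rewrite finset.subUset HD.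
  (* The route from [u] to [v] and on to [k] costs [b + 4 * b]; the spanner follows greedy pairs
     from [u] to [k], then goes back to [v]. *)
  have duk : d u k <= 5 * b.
    apply: (dP u k).2.
    apply: linked_transW luv (linked_sym symD (linked_edges_mono HTD lk')) _; lra.
  have /pairs luk : linked (pairs_cost C0 d E) u k (t * d u k).
    by apply: (covE (u, k)); rewrite inE uK kK.
  apply: linked_transW luk lk' _.
  have : t * d u k <= t * (5 * b) by rewrite ler_wpM2l // (le_trans ler01).
  lra.
Qed.

End TerminalSpanner.

(** * Prioritized distortion *)

Definition level (j : nat) : nat := up_log 2 (up_log 2 j).

(* [6 * p.+1 * p.+2 / rho] is the inverse of the scale by which the weights
   are distorted at level [p]; the other factor is the stretch there. *)
Definition distortion (j : nat) : nat :=
  let p := level j in (6 * p.+1 * p.+2 * (5 * greedy_stretch p + 4))%N.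

Lemma le_level j : (j <= 2 ^ 2 ^ level j)%N.
Proof.
by apply: leq_trans (up_logP j (isT : (1 < 2)%N)) _; rewrite leq_exp2l // up_logP.
Qed.

Lemma level_le j : (level j <= j)%N.
Proof.
have le m : (up_log 2 m <= m)%N by apply: up_log_min => //; apply/ltnW/ltn_expl.
exact: leq_trans (le _) (le _).
Qed.

Lemma up_log_le_ln (R : realType) (j : nat) : (1 < j)%N ->
  (up_log 2 j)%:R <= 1 + 2 * ln (j%:R : R).
Proof.
move=> j1; have /andP[lt _] := up_log_bounds (isT : (1 < 2)%N) j1.
set k := up_log 2 j in lt *; have k0 : (0 < k)%N by rewrite up_log_gt0 ?j1.
have le : (2 : R) ^+ k.-1 <= j%:R by rewrite -natrX ler_nat ltnW.
have j0 : 0 < j%:R :> R by rewrite ltr0n ltnW.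
have ln2 := ln2_ge_half R.
have : ln ((2 : R) ^+ k.-1) <= ln (j%:R : R) by rewrite ler_ln ?posrE ?exprn_gt0.
rewrite lnXn // -[leLHS]mulr_natl.
have -> : k%:R = k.-1%:R + 1 :> R by rewrite natr1 prednK.
have : k.-1%:R * (1 / 2) <= k.-1%:R * ln 2 :> R by rewrite ler_wpM2l.
lra.
Qed.

(** Here [2 ^ p] is of order [ln j], and the factors [p.+1], [p.+2] and [num_scales p] are each of
    order [ln (ln j)], whence the exponent 3. *)
Lemma distortion_soft_O (R : realType) :
  soft_O (fun j => (distortion j)%:R : R) (fun j => ln (j%:R : R)).
Proof.
exists 3%N; apply/eqO_exP.
(* The product of the bounds [p + 1 <= 8 * l], [p + 2 <= 9 * l], [2 ^ p <= 6 * L] and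
   [4 * p + 32 <= 60 * l]; the inner 9 comes from [5 * z + 4 <= 9 * z]. *)
pose c : R := 6 * 8 * 9 * (9 * (2 ^+ 14 * 6 * 60)).
exists c; first by rewrite /c !mulr_gt0 ?exprn_gt0 ?ltr0n.
near=> j.
(* Beyond this threshold [ln (ln j)] is at least 1, so additive constants are absorbed. *)
have jbig : expR (expR 1) <= j%:R :> R.
  by near: j; apply: nbhs_infty_ger.
have j0 : 0 < j%:R :> R := lt_le_trans (expR_gt0 _) jbig.
set L := ln (j%:R : R); set l := ln L.
have Lbig : expR 1 <= L by rewrite -(expRK (expR 1)) ler_ln ?posrE ?expR_gt0.
have L0 : 0 < L := lt_le_trans (expR_gt0 _) Lbig.
have l1 : 1 <= l by rewrite -(expRK 1) ler_ln ?posrE ?expR_gt0.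
have e1 : 1 + 1 <= expR 1 :> R by apply: expR_ge1Dx.
have L2 : 2 <= L by move: Lbig e1; lra.
have j1 : (1 < j)%N.
  rewrite -(ltr_nat R); apply: (lt_le_trans _ jbig).
  by have := @expR_ge1Dx R (expR 1); lra.
rewrite [leLHS]ger0_norm ?ler0n // ger0_norm; last first.
  by rewrite mulr_ge0 ?exprn_ge0 // ltW // (lt_le_trans ltr01).
rewrite /distortion /level; set u := up_log 2 j; set p := up_log 2 u.
have uL : u%:R <= 3 * L by have := up_log_le_ln R j1; rewrite -/L -/u; lra.
have u1 : (1 < u)%N.
  rewrite ltnNge; apply/negP => u1.
  have : (j <= 2 ^ 1)%N.
    by apply: leq_trans (up_logP j (isT : (1 < 2)%N)) _; rewrite leq_exp2l.
  rewrite -(ler_nat R) => j2.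
  by have := @expR_ge1Dx R (expR 1); move: e1 jbig j2; lra.
have pl : p%:R <= 7 * l.
  have := up_log_le_ln R u1; rewrite -/p.
  have u0 : 0 < u%:R :> R by rewrite ltr0n ltnW.
  have : ln (u%:R : R) <= ln (3 * L) by rewrite ler_ln ?posrE // mulr_gt0.
  rewrite lnM ?posrE // -/l.
  have : ln 3 <= 2 :> R.
    have -> : 3 = 1 + 2 :> R by lra.
    by apply: le_ln1Dx; lra.
  lra.
have yL : (2 ^ p)%:R <= 6 * L.
  have /andP[lt _] := up_log_bounds (isT : (1 < 2)%N) u1.
  have p0 : (0 < p)%N by rewrite up_log_gt0 ?u1.
  have : ((2 ^ p)%:R : R) <= 2 * u%:R.
    by rewrite -natrM ler_nat -(prednK p0) expnS leq_mul2l ltnW.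
  by move: uL; lra.
have Ll1 : 1 <= L * l by rewrite mulr_ege1 //; lra.
set x : R := p%:R in pl; set y : R := (2 ^ p)%:R in yL.
have x0 : 0 <= x by apply: ler0n.
have y0 : 0 <= y by apply: ler0n.
have -> : (6 * p.+1 * p.+2 * (5 * greedy_stretch p + 4))%:R =
    6 * (x + 1) * (x + 2) * (5 * (y * 2 ^+ 14 * (4 * x + 32)) + 4) :> R.
  rewrite !natrM natrD natrM /greedy_stretch /num_scales !natrM natrD expnD natrM.
  by rewrite -/y [(2 ^ 14)%:R]natrX natrM -/x -[p.+2]addn2 -[p.+1]addn1 !natrD.
have -> : c * (L * l ^+ 3) =
    6 * (8 * l) * (9 * l) * (9 * (6 * L * 2 ^+ 14 * (60 * l))).
  by rewrite /c; ring.
have k1 : 1 <= 2 ^+ 14 :> R by rewrite exprn_ege1 // ler1n.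
have k0 : 0 <= 2 ^+ 14 :> R by rewrite exprn_ge0.
set k := 2 ^+ 14 in k0 k1 *.
have yk : y * k <= 6 * L * k by rewrite ler_wpM2r.
have z1 : y * k * (4 * x + 32) <= 6 * L * k * (60 * l).
  by rewrite ler_pM ?mulr_ge0 //; lra.
have z2 : 1 <= 6 * L * k * (60 * l).
  have -> : 6 * L * k * (60 * l) = (6 * k * 60) * (L * l) by ring.
  by rewrite mulr_ege1 //; lra.
have z0 : 0 <= y * k * (4 * x + 32) by rewrite !mulr_ge0 //; lra.
apply: ler_pM; first by rewrite !mulr_ge0 //; lra.
- by lra.
- by apply: ler_pM; rewrite ?mulr_ge0 //; lra.
- by lra.
Unshelve. all: end_near.
Qed.

(** * Transfer to graph distances and lightness *)

Section FinalAssembly.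
Variables (R : realType) (V : finType) (G : wgraph R V).

(* The weights are extended by zero outside of the edges of [G]. *)
Definition weight0 (e : {set V}) : R := if e \in edges G then weight G e else 0.

Lemma weight0_ge0 e : 0 <= weight0 e.
Proof. by rewrite /weight0; case: ifP => // /weight_ge0. Qed.

Lemma walk_weight0 (D : {set {set V}}) u q : D \subset edges G ->
  path (adj D) u q -> walk_weight G u q = walk_cost weight0 u q.
Proof.
move=> /fintype.subsetP DG; rewrite /walk_weight /walk_cost.
elim: q u => [|v q IH] u /=; first by rewrite !big_nil.
by move=> /andP[/DG uv /IH]; rewrite !big_cons /= => ->; rewrite /weight0 uv.
Qed.

Lemma dist_le_linked (H : {set {set V}}) x y (c : R) : 0 < c ->
  H \subset edges G ->
  (forall b, linked (edge_cost weight0 (edges G)) x y b ->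
     linked (edge_cost weight0 H) x y (c * b)) ->
  (dist G H x y <= c%:E * dist G (edges G) x y)%E.
Proof.
move=> c0 HG h; rewrite /dist -ereal_inf_pZl //.
apply: le_ereal_inf_tmp => _ [_ [q [qp lq] <-] <-].
have l : linked (edge_cost weight0 (edges G)) x y (walk_weight G x q).
  by rewrite (walk_weight0 (subxx _) qp) -lq; apply: walk_linked qp; apply: weight0_ge0.
have [q' [qp' lq' _ le]] := linked_walk weight0_ge0 (h _ l).
apply: (@le_trans _ _ (walk_weight G x q')%:E).
  by apply: ereal_inf_lbound; exists q'.
by rewrite -EFinM lee_fin (walk_weight0 HG qp').
Qed.

Lemma total_weight0 (D : {set {set V}}) : D \subset edges G ->
  total_weight G D = \sum_(e in D) weight0 e.
Proof.
by move=> /fintype.subsetP DG; apply: eq_bigr => e /DG; rewrite /weight0 => ->.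
Qed.

Lemma lightness_le (T H : {set {set V}}) (r : R) : 0 <= r ->
  T \subset edges G -> H \subset edges G ->
  \sum_(e in H) weight0 e <= r * \sum_(e in T) weight0 e ->
  (lightness G T H <= r%:E)%E.
Proof.
move=> r0 TG HG; rewrite /lightness !total_weight0 //.
set a := \sum_(e in H) _; set b := \sum_(e in T) _ => le.
have a0 : 0 <= a by apply: sumr_ge0 => e _; apply: weight0_ge0.
have b0 : 0 <= b by apply: sumr_ge0 => e _; apply: weight0_ge0.
(* If the tree has weight zero, so has [H], and the quotient is 0. *)
rewrite inver; case: eqP => [b_0|/eqP bn0].
  have -> : a = 0 by apply/le_anti; rewrite a0 andbT; move: le; rewrite b_0 mulr0.
  by rewrite mul0e lee_fin.
by rewrite -EFinM lee_fin ler_pdivrMr // lt_neqAle eq_sym bn0.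
Qed.

Variables (T : {set {set V}}) (rho : R).
Hypothesis TG : T \subset edges G.
Hypothesis conn_T : connected_edges T.
Hypothesis rho_gt0 : 0 < rho.
Hypothesis rho_lt1 : rho < 1.

Lemma card_tree_edge e : e \in T -> #|e| = 2%N.
Proof. by move=> /(fintype.subsetP TG)/card_edge. Qed.

(* Multiplying the weights outside of [T] by [1 / delta] turns a constant
   lightness into lightness [1 + O(delta)], at the cost of a factor [1 / delta]
   in the stretch. *)
Lemma scaled_terminal_spanner (K : {set V}) (p : nat) :
  (0 < #|K|)%N -> (#|K| <= 2 ^ 2 ^ p)%N ->
  exists X : {set {set V}}, [/\ X \subset edges G,
    \sum_(e in X) weight0 e <=
      rho / (p.+1 * p.+2)%:R * \sum_(e in T) weight0 e &
    forall u v b, u \in K -> linked (edge_cost weight0 (edges G)) u v b ->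
      linked (edge_cost weight0 (X :|: T)%SET) u v
        ((6 * p.+1 * p.+2 * (5 * greedy_stretch p + 4))%:R / rho * b)].
Proof.
move=> K0 Kp; pose m : R := (p.+1 * p.+2)%:R.
have m1 : 1 <= m by rewrite ler1n muln_gt0.
(* The 6 cancels the lightness constant of [terminal_spanner]; [m] makes the budgets of all levels
   summable. *)
pose delta := rho / (6 * m).
have d0 : 0 < delta by rewrite divr_gt0 // mulr_gt0 // (lt_le_trans ltr01).
have d1 : delta <= 1.
  rewrite /delta ler_pdivrMr ?mul1r; last by rewrite mulr_gt0 // (lt_le_trans ltr01).
  by apply: le_trans (ltW rho_lt1) _; rewrite mulr_ege1 // ler1n.
pose w e := if e \in T then weight0 e else weight0 e / delta.
have w0 e : 0 <= w e.
  by rewrite /w; case: ifP => _; [|apply: divr_ge0 (ltW d0)]; apply: weight0_ge0.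
have le_w e : weight0 e <= w e.
  rewrite /w; case: ifP => // _; rewrite ler_pdivlMr // ler_piMr //.
  exact: weight0_ge0.
have w_le e : w e <= delta^-1 * weight0 e.
  rewrite /w; case: ifP => _; last by rewrite mulrC.
  by rewrite ler_peMl ?weight0_ge0 // invf_ge1.
have [H [HG wH spanH]] := terminal_spanner w0 TG card_tree_edge conn_T K0 Kp.
have wT : \sum_(e in T) w e = \sum_(e in T) weight0 e.
  by apply: eq_bigr => e eT; rewrite /w eT.
exists (H :\: T)%SET; split.
- exact: fintype.subset_trans (finset.subsetDl _ _) HG.
- have -> : \sum_(e in (H :\: T)%SET) weight0 e =
      delta * \sum_(e in (H :\: T)%SET) w e.
    rewrite mulr_sumr; apply: eq_bigr => e /finset.setDP[_ /negbTE eT].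
    by rewrite /w eT mulrC divfK // gt_eqF.
  have : \sum_(e in (H :\: T)%SET) w e <= 6 * \sum_(e in T) weight0 e.
    rewrite -wT; apply: le_trans wH; rewrite [leRHS](big_setID T) /= lerDr.
    exact: sumr_ge0.
  move=> le; apply: le_trans (ler_wpM2l (ltW d0) le) _.
  rewrite mulrA (_ : delta * 6 = rho / m) //.
  by rewrite /delta; field; rewrite nat1r -natrD !pnatr_eq0.
- move=> u v b uK l.
  (* As [weight0 <= w <= delta^-1 * weight0], passing to [w] and back costs only the factor
     [delta^-1]. *)
  have lw : linked (edge_cost w (edges G)) u v (delta^-1 * b).
    apply: linked_lift l; first by rewrite invr_ge0 ltW.
    move=> x y c [xy ->]; apply: linkedW (w_le _) _; exact: linked1.
  have l' := spanH u v _ uK lw.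
  have -> : ((H :\: T) :|: T = H :|: T)%SET.
    by apply/setP => e; rewrite !inE; case: (e \in T); rewrite ?orbT ?orbF.
  set c := _ / rho * b.
  have -> : c = 1 * ((5 * (greedy_stretch p)%:R + 4) * (delta^-1 * b)).
    rewrite /c /delta invf_div /m; move: (greedy_stretch p) => g.
    by rewrite !natrM natrD natrM; ring.
  apply: linked_lift l' => // x y a [xy ->]; rewrite mul1r.
  apply: linkedW (le_w _) _; exact: linked1.
Qed.

End FinalAssembly.

(** The terms are [1 / (p + 1) - 1 / (p + 2)]; so the levels together add at most [rho * w(T)]. *)
Lemma sum_telescope_le1 (R : realType) n :
  \sum_(p < n) ((p.+1 * p.+2)%:R)^-1 <= 1 :> R.
Proof.
suff -> : \sum_(p < n) ((p.+1 * p.+2)%:R)^-1 = 1 - (n.+1%:R)^-1 :> R.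
  by rewrite gerBl invr_ge0.
elim: n => [|n IH]; first by rewrite big_ord0 invr1 subrr.
rewrite big_ord_recr /= IH natrM -[n.+2]addn1 natrD; field.
by rewrite !nat1r natr1 !pnatr_eq0.
Qed.

Theorem mainTheorem1 (R : realType) :
  exists alpha : nat -> R,
    soft_O alpha (fun j : nat => ln (j%:R : R)) /\
    forall (V : finType) (G : wgraph R V) (T : {set {set V}}) (rho : R)
           (n : nat) (v : 'I_n -> V),
      connected_edges (edges G) ->
      minimum_spanning_tree G T ->
      0 < rho -> rho < 1 ->
      bijective v ->
      exists H : {set {set V}},
        [/\ H \subset edges G,
            (lightness G T H <= (1 + rho)%:E)%E &
            forall j i : 'I_n, (j < i)%N ->
              (dist G H (v j) (v i)
               <= (alpha j.+1 / rho)%:E * dist G (edges G) (v j) (v i))%E].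
Proof.
exists (fun j => (distortion j)%:R); split; first exact: distortion_soft_O.
move=> V G T rho n v _ [[TG conn_T _] _] rho0 rho1 _.
pose K p := [set v i | i : 'I_n & (i < 2 ^ 2 ^ p)%N]%SET.
have K_le p : (#|K p| <= 2 ^ 2 ^ p)%N.
  apply: leq_trans (leq_imset_card _ _) _.
  rewrite cardE -(size_map val) -[leqRHS](size_iota 0); apply: uniq_leq_size.
    by rewrite map_inj_uniq ?enum_uniq //; apply: val_inj.
  by move=> _ /mapP[i iP ->]; move: iP; rewrite mem_enum mem_iota inE.
have /choice[X XP] : forall p, exists X : {set {set V}}, [/\ X \subset edges G,
    \sum_(e in X) weight0 G e <=
      rho / (p.+1 * p.+2)%:R * \sum_(e in T) weight0 G e &
    forall u z b, u \in K p -> linked (edge_cost (weight0 G) (edges G)) u z b ->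
      linked (edge_cost (weight0 G) (X :|: T)%SET) u z
        ((6 * p.+1 * p.+2 * (5 * greedy_stretch p + 4))%:R / rho * b)].
  (* The terminal set is empty only for [n = 0]; the empty edge set then works. *)
  move=> p; have [K0|K0] := posnP #|K p|; last first.
    exact: scaled_terminal_spanner.
  exists finset.set0; split; rewrite ?finset.sub0set ?big_set0 //.
    rewrite mulr_ge0 ?divr_ge0 ?ler0n ?(ltW rho0) // sumr_ge0 // => e _.
    exact: weight0_ge0.
  by move=> u z b; move/eqP: K0; rewrite cards_eq0 => /eqP->; rewrite inE.
(* Levels up to [n] suffice, since [level j.+1 <= j.+1 <= n]. *)
pose U := (\bigcup_(p < n.+1) X p)%SET.
have UG : U \subset edges G by apply/finset.bigcupsP => p _; case: (XP p).
have HG : (T :|: U)%SET \subset edges G by rewrite finset.subUset TG.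
have W0 : 0 <= \sum_(e in T) weight0 G e.
  by apply: sumr_ge0 => e _; apply: weight0_ge0.
exists (T :|: U)%SET; split=> //.
- apply: lightness_le => //; first by rewrite addr_ge0 // ltW.
  apply: le_trans (sum_setU_le _ _ (weight0_ge0 G)) _.
  rewrite mulrDl mul1r lerD2l.
  have -> : U = (\bigcup_(p in [set: 'I_n.+1]) X p)%SET.
    by apply: eq_bigl => p; rewrite inE.
  apply: le_trans (sum_bigcup_le _ _ (weight0_ge0 G)) _.
  apply: (@le_trans _ _ (\sum_(p < n.+1)
      rho * ((p.+1 * p.+2)%:R)^-1 * \sum_(e in T) weight0 G e)).
    rewrite (eq_bigl predT); last by move=> p; rewrite inE.
    by apply: ler_sum => p _; case: (XP p).
  rewrite -mulr_suml ler_wpM2r // -mulr_sumr ler_piMr ?(ltW rho0) //.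
  exact: sum_telescope_le1.
- move=> j i _; set p := level j.+1.
  have p_n : (p < n.+1)%N.
    by rewrite ltnS (leq_trans (level_le _)).
  (* Indices start at 0, so rank [j.+1 <= 2 ^ 2 ^ p] means [j < 2 ^ 2 ^ p]. Only the better ranked
     vertex has to be a terminal. *)
  have jK : v j \in K p by apply/imsetP; exists j; rewrite // inE le_level.
  apply: dist_le_linked => //.
    by rewrite divr_gt0 // ltr0n /distortion !muln_gt0 /= addn_gt0 orbT.
  move=> b l; have [_ _ /(_ _ _ _ jK l)] := XP p; apply: linked_edges_mono.
  rewrite finset.subUset finset.subsetUl andbT.
  apply: fintype.subset_trans (finset.subsetUr _ _).
  exact: (finset.bigcup_sup (Ordinal p_n)).
Qed.
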